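(* Let $n$ be a fixed odd number, and let $f\in D\left(\frac{\overline{\partial}}{2}\right)$ and $g\in D\left(\mathcal{M}_{P_1^n}\right)$. Then $$\left\langle\frac{\overline{\partial}}{2}(f),g\right\rangle_{\mathcal{F}(\mathbb{R}^{n+1})}=\left\langle f,\mathcal{M}_{P_1^n}g\right\rangle_{\mathcal{F}(\mathbb{R}^{n+1})}.$$ In particular, the adjoint operator of the hypercomplex derivative is given by $\mathcal{M}_{P_1^n}$, i.e. $\left(\mathcal{M}_{P_1^n}\right)^*=\frac{\overline{\partial}}{2}$.
   Context: $\mathbb{R}_n$ is the real Clifford algebra generated by $e_1,\dots,e_n$ with $e_\ell e_m+e_me_\ell=0$ for $\ell\ne m$ and $e_\ell^2=-1$; for $a=\sum_A a_Ae_A$, $|a|=(\sum_A a_A^2)^{1/2}$; $a\mapsto\bar a$ is Clifford conjugation (the anti-automorphism with $\overline{e_\ell}=-e_\ell$). A point $(x_0,\dots,x_n)\in\mathbb{R}^{n+1}$ is identified with the paravector $x=x_0+\underline{x}$, $\underline{x}=\sum_{\ell=1}^n x_\ell e_\ell$; $\bar x=x_0-\underline{x}$. The Clifford-Appell polynomials are $$P_k^n(x):=\sum_{s=0}^k T_s^k(n)\,x^{k-s}\bar x^{s},\qquad T_s^k(n):=\binom{k}{s}\frac{\left(\frac{n+1}{2}\right)_{k-s}\left(\frac{n-1}{2}\right)_s}{(n)_k},$$ where $(a)_0=1$ and $(a)_s=a(a+1)\cdots(a+s-1)$ for $s>0$; they are axially monogenic. $\mathcal{F}(\mathbb{R}^{n+1}):=\{\sum_{k=0}^\infty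 P_k^n(x)\alpha_k:\alpha_k\in\mathbb{R}_n,\ \sum_k k!|\alpha_k|^2<\infty\}$ with inner product $\langle\sum P_k^n\alpha_k,\sum P_k^n\beta_k\rangle_{\mathcal{F}(\mathbb{R}^{n+1})}=\sum_k k!\,\overline{\alpha_k}\beta_k$. A function $f$ on an axially symmetric slice domain (e.g. $\mathbb{R}^{n+1}$) is axially monogenic if it is $C^1$, satisfies $\left(\partial_{x_0}+\sum_{i=1}^n e_i\partial_{x_i}\right)f=0$, and has the form $f(x_0+\underline{x})=A(x_0,|\underline{x}|)+\frac{\underline{x}}{|\underline{x}|}B(x_0,|\underline{x}|)$ with $\mathbb{R}_n$-valued $A,B$ such that $A$ is even and $B$ is odd in the second variable. $GCK[f_0]$ is the unique axially monogenic function of the form $\sum_{j\ge0}\underline{x}^jf_j(x_0)$ whose restriction to the real line is the real-analytic function $f_0$, and $A\odot_{GCK}B:=GCK[A(x_0,0)B(x_0,0)]$ for axially monogenic $A,B$. The creation operator is $\mathcal{M}_{P_1^n}(f):=P_1^n\odot_{GCK}f$, with $P_1^n(x)=\frac{1}{2n}\left((n+1)x+(n-1)\bar x\right)$, and the annihilation operator is the hypercomplex derivative $\frac{\overline{\partial}}{2}:=\frac12\left(\partial_{x_0}-\sum_{\ell=1}^n e_\ell\partial_{x_\ell}\right)$. Their domains are $D(\mathcal{M}_{P_1^n}):=\{f\in\mathcal{F}(\mathbb{R}^{n+1}):\mathcal{M}_{P_1^n}(f)\in\mathcal{F}(\mathbb{R}^{n+1})\}$ and $D(\frac{\overline{\partial}}{2}):=\{f\in\mathcal{F}(\mathbb{R}^{n+1}):\frac{\overline{\partial}}{2}(f)\in\mathcal{F}(\mathbb{R}^{n+1})\}$.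 *)

(* Defs.v *)
From HB Require Import structures.
From mathcomp Require Import all_boot all_order all_algebra.
From mathcomp Require Import ring.

Set Implicit Arguments.
Unset Strict Implicit.
Unset Printing Implicit Defensive.

Import Order.TTheory GRing.Theory Num.Theory.

Local Open Scope ring_scope.

(* An element [a] of the Clifford algebra R_n is its family of coordinates    *)
(* [a A] in the basis e_A = e_{i_1} ... e_{i_p}, A = {i_1 < ... < i_p}; the   *)
(* generators are indexed by 'I_n, i.e. from 0 to n - 1.                      *)
Definition clifford (R : comNzRingType) (n : nat) := {ffun {set 'I_n} -> R}.

HB.instance Definition _ (R : comNzRingType) (n : nat) :=
  GRing.Zmodule.copy (clifford R n) {ffun {set 'I_n} -> R}.

Section CliffordAlgebra.
Context {R : comNzRingType} {n : nat}.
Implicit Types (A B C D : {set 'I_n}) (a b c : clifford R n).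

Definition symdiff A B : {set 'I_n} := [set i | (i \in A) (+) (i \in B)].

(* e_A * e_B = clsign A B *: e_(symdiff A B): a pair i \in A, j \in B with    *)
(* j < i costs one anticommutation, and a pair with j = i gives e_i ^ 2 = -1. *)
Definition clsign A B : R :=
  \prod_(i < n) \prod_(j < n | (j <= i)%N) (-1) ^+ ((i \in A) && (j \in B)).

Definition cl_scale (k : R) a : clifford R n := [ffun A => k * a A].

Lemma cl_scaleA j k a : cl_scale j (cl_scale k a) = cl_scale (j * k) a.
Proof. by apply/ffunP => A; rewrite !ffunE mulrA. Qed.

Lemma cl_scale1 : left_id 1 cl_scale.
Proof. by move=> a; apply/ffunP => A; rewrite ffunE mul1r. Qed.

Lemma cl_scaleDr : right_distributive cl_scale +%R.
Proof. by move=> k a b; apply/ffunP => A; rewrite !ffunE mulrDr. Qed.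

Lemma cl_scaleDl a : {morph cl_scale^~ a : j k / j + k}.
Proof. by move=> j k; apply/ffunP => A; rewrite !ffunE mulrDl. Qed.

HB.instance Definition _ := GRing.Zmodule_isLmodule.Build R (clifford R n)
  cl_scaleA cl_scale1 cl_scaleDr cl_scaleDl.

Lemma clZE (k : R) a A : (k *: a) A = k * a A.
Proof. by rewrite ffunE. Qed.

Definition cl_mul a b : clifford R n :=
  [ffun C => \sum_A \sum_(B | symdiff A B == C) clsign A B * a A * b B].

Definition cl_basis B : clifford R n := [ffun A => (A == B)%:R].

Definition cl_one : clifford R n := cl_basis set0.

Definition cl_gen (l : 'I_n) : clifford R n := cl_basis [set l].

(* clsign A A = (-1) ^ (p * (p + 1) / 2) with p = #|A|; see cl_conjM and      *)
(* cl_conj_gen below.                                                         *)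
Definition cl_conj a : clifford R n := [ffun A => clsign A A * a A].

Lemma symdiffC A B : symdiff A B = symdiff B A.
Proof. by apply/setP => i; rewrite !inE addbC. Qed.

Lemma symdiffA A B C : symdiff A (symdiff B C) = symdiff (symdiff A B) C.
Proof. by apply/setP => i; rewrite !inE addbA. Qed.

Lemma symdiff0s A : symdiff set0 A = A.
Proof. by apply/setP => i; rewrite !inE. Qed.

Lemma symdiffs0 A : symdiff A set0 = A.
Proof. by rewrite symdiffC symdiff0s. Qed.

Lemma symdiffss A : symdiff A A = set0.
Proof. by apply/setP => i; rewrite !inE addbb. Qed.

Lemma symdiffKs A B : symdiff A (symdiff A B) = B.
Proof. by rewrite symdiffA symdiffss symdiff0s. Qed.

Lemma symdiff_eq A B C : (symdiff A B == C) = (B == symdiff A C).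
Proof. by apply/eqP/eqP => [<-|->]; rewrite symdiffKs. Qed.

Lemma clsignDl A B C : clsign (symdiff A B) C = clsign A C * clsign B C.
Proof.
rewrite /clsign -big_split; apply: eq_bigr => i _ /=.
rewrite -big_split; apply: eq_bigr => j _ /=.
by rewrite inE andb_addl signr_addb.
Qed.

Lemma clsignDr A B C : clsign A (symdiff B C) = clsign A B * clsign A C.
Proof.
rewrite /clsign -big_split; apply: eq_bigr => i _ /=.
rewrite -big_split; apply: eq_bigr => j _ /=.
by rewrite inE andb_addr signr_addb.
Qed.

Lemma clsign0l A : clsign set0 A = 1.
Proof. by rewrite /clsign big1 // => i _; rewrite big1 // => j _; rewrite inE. Qed.

Lemma clsign0r A : clsign A set0 = 1.
Proof.
by rewrite /clsign big1 // => i _; rewrite big1 // => j _; rewrite inE andbF.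
Qed.

Lemma clsign_sqr A B : clsign A B * clsign A B = 1.
Proof. by rewrite -clsignDl symdiffss clsign0l. Qed.

Lemma clsign1 i j : clsign [set i] [set j] = (-1) ^+ (j <= i)%N.
Proof.
rewrite /clsign (bigD1 i) //= [X in _ * X]big1 ?mulr1; last first.
  by move=> k /negbTE ki; rewrite big1 // => l _; rewrite inE ki.
case: (leqP j i) => ji.
  rewrite (bigD1 j) //= !inE !eqxx big1 ?mulr1 // => l /andP[_ /negbTE lj].
  by rewrite !inE lj andbF.
rewrite big1 // => l li; rewrite !inE eqxx /=.
by case: eqP => // lj; move: ji; rewrite -lj ltnNge li.
Qed.

Lemma cl_mulE a b C :
  cl_mul a b C = \sum_A clsign A (symdiff A C) * a A * b (symdiff A C).
Proof.
rewrite ffunE; apply: eq_bigr => A _.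
by rewrite (big_pred1 (symdiff A C)) // => B; rewrite symdiff_eq.
Qed.

Lemma cl_mulA : associative cl_mul.
Proof.
move=> a b c; apply/ffunP => D; rewrite !cl_mulE.
under eq_bigr do rewrite cl_mulE big_distrr /=.
under [RHS]eq_bigr do rewrite cl_mulE big_distrr big_distrl /=.
rewrite [RHS]exchange_big /=; apply: eq_bigr => A _.
rewrite [RHS](reindex_inj (can_inj (symdiffKs A))) /=.
apply: eq_bigr => B _.
have -> : symdiff (symdiff A B) D = symdiff B (symdiff A D).
  by rewrite [symdiff A B]symdiffC symdiffA.
rewrite symdiffKs; set C := symdiff B (symdiff A D).
have -> : symdiff A D = symdiff B C by rewrite symdiffKs.
rewrite clsignDl clsignDr; ring.
Qed.

Lemma cl_mul1l : left_id cl_one cl_mul.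
Proof.
move=> a; apply/ffunP => C; rewrite cl_mulE (bigD1 set0) //= big1 => [|A A0].
  by rewrite ffunE eqxx symdiff0s clsign0l !mul1r addr0.
by rewrite ffunE (negbTE A0) mulr0 mul0r.
Qed.

Lemma cl_mul1r : right_id cl_one cl_mul.
Proof.
move=> a; apply/ffunP => C; rewrite cl_mulE (bigD1 C) //= big1 => [|A AC].
  by rewrite ffunE symdiffss eqxx clsign0r mul1r mulr1 addr0.
by rewrite ffunE symdiff_eq symdiffs0 eq_sym (negbTE AC) mulr0.
Qed.

Lemma cl_mulDl : left_distributive cl_mul +%R.
Proof.
move=> a b c; apply/ffunP => C; rewrite [RHS]ffunE !cl_mulE -big_split /=.
by apply: eq_bigr => A _; rewrite ffunE mulrDr mulrDl.
Qed.

Lemma cl_mulDr : right_distributive cl_mul +%R.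
Proof.
move=> a b c; apply/ffunP => C; rewrite [RHS]ffunE !cl_mulE -big_split /=.
by apply: eq_bigr => A _; rewrite ffunE mulrDr.
Qed.

Lemma cl_one_neq0 : cl_one != 0.
Proof.
apply/eqP => /ffunP /(_ set0); rewrite !ffunE eqxx => /eqP.
by rewrite oner_eq0.
Qed.

HB.instance Definition _ := GRing.Zmodule_isNzRing.Build (clifford R n)
  cl_mulA cl_mul1l cl_mul1r cl_mulDl cl_mulDr cl_one_neq0.

Lemma clME a b C :
  (a * b) C = \sum_A clsign A (symdiff A C) * a A * b (symdiff A C).
Proof. exact: cl_mulE. Qed.

Lemma cl_scaleAl (k : R) a b : k *: (a * b) = (k *: a) * b.
Proof.
apply/ffunP => C; rewrite clZE !clME mulr_sumr.
by apply: eq_bigr => A _; rewrite clZE !mulrA [k * _]mulrC.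
Qed.

HB.instance Definition _ :=
  GRing.Lmodule_isLalgebra.Build R (clifford R n) cl_scaleAl.

Lemma cl_scaleAr (k : R) a b : k *: (a * b) = a * (k *: b).
Proof.
apply/ffunP => C; rewrite clZE !clME mulr_sumr.
by apply: eq_bigr => A _; rewrite clZE mulrCA.
Qed.

HB.instance Definition _ :=
  GRing.Lalgebra_isAlgebra.Build R (clifford R n) cl_scaleAr.

Lemma cl_basisM A B :
  cl_basis A * cl_basis B = clsign A B *: cl_basis (symdiff A B).
Proof.
apply/ffunP => C; rewrite clME clZE (bigD1 A) //= big1 => [|D DA]; last first.
  by rewrite ffunE (negbTE DA) mulr0 mul0r.
rewrite !ffunE eqxx mulr1 addr0 symdiff_eq.
by case: eqP => [->|_]; rewrite ?mulr0 ?symdiffKs.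
Qed.

Lemma cl_basis_recr A (l : 'I_n) : (forall i, i \in A -> (i < l)%N) ->
  cl_basis A * cl_gen l = cl_basis (l |: A).
Proof.
move=> Al; rewrite cl_basisM.
have -> : symdiff A [set l] = l |: A.
  apply/setP => i; rewrite !inE; case: eqP => [->|_]; rewrite ?addbF //.
  by rewrite addbT; apply/negP => /Al; rewrite ltnn.
rewrite /clsign big1 ?scale1r // => i _; rewrite big1 // => j ji.
rewrite inE; have [/Al il|//] := boolP (i \in A).
by case: eqP => // jl; move: il; rewrite -jl ltnNge ji.
Qed.

Lemma cl_gen_sqr (l : 'I_n) : cl_gen l ^+ 2 = -1.
Proof. by rewrite expr2 cl_basisM clsign1 leqnn symdiffss scaleN1r. Qed.

Lemma cl_gen_anticomm (l m : 'I_n) : l != m ->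
  cl_gen l * cl_gen m + cl_gen m * cl_gen l = 0.
Proof.
move=> lm; rewrite !cl_basisM !clsign1 [symdiff [set m] _]symdiffC -scalerDl.
have : (l : nat) != m by [].
rewrite neq_ltn => /orP[] h; rewrite (ltnW h) leqNgt h /= expr0 expr1.
  by rewrite subrr scale0r.
by rewrite addNr scale0r.
Qed.

Lemma cl_conjM a b : cl_conj (a * b) = cl_conj b * cl_conj a.
Proof.
apply/ffunP => C; rewrite ffunE !clME mulr_sumr.
rewrite [RHS](reindex_inj (h := fun A => symdiff A C)) /=; last first.
  by move=> A B; rewrite ![symdiff _ C]symdiffC; apply: can_inj (symdiffKs C) _ _.
apply: eq_bigr => A _; set B := symdiff A C.
have : C = symdiff A B by rewrite symdiffKs.
move: B => B ->.
have -> : symdiff B (symdiff A B) = A by rewrite symdiffC -symdiffA symdiffss symdiffs0.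
rewrite !ffunE clsignDl !clsignDr.
transitivity ((clsign A B * clsign A B) *
    (clsign B A * clsign A A * clsign B B * a A * b B)); first by ring.
rewrite clsign_sqr; ring.
Qed.

Lemma cl_conj_gen (l : 'I_n) : cl_conj (cl_gen l) = - cl_gen l.
Proof.
apply/ffunP => C; rewrite !ffunE; case: eqP => [->|]; last by rewrite mulr0 oppr0.
by rewrite clsign1 leqnn mulN1r.
Qed.

Lemma cl_conj_scalar (k : R) : cl_conj k%:A = k%:A.
Proof.
apply/ffunP => C; rewrite !ffunE; case: eqP => [->|]; first by rewrite clsign0l mul1r.
by rewrite !mulr0.
Qed.

Lemma cl_conj_linear : linear (cl_conj : clifford R n -> clifford R n).
Proof. by move=> k a b; apply/ffunP => C; rewrite !ffunE mulrDr mulrCA. Qed.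

HB.instance Definition _ := GRing.isLinear.Build R (clifford R n) (clifford R n)
  _ cl_conj cl_conj_linear.

End CliffordAlgebra.

From mathcomp Require Import all_classical all_reals all_analysis.

Import numFieldNormedType.Exports.

Local Open Scope classical_set_scope.

Section Fock.
Context (R : realType) (n : nat).

Local Notation Cl := (clifford R n).
(* The point (x_0, ..., x_n) of R^(n+1) is the row vector x with entries x 0 l.*)
Local Notation Pt := 'rV[R]_n.+1.

Implicit Types (x : Pt) (f g F : Pt -> Cl) (alpha beta : nat -> Cl).

Definition cl_norm (a : Cl) : R := Num.sqrt (\sum_A a A ^+ 2).

(* R_n being finite-dimensional, limits, sums and derivatives of R_n-valued   *)
(* objects are taken coordinate by coordinate in the basis e_A.               *)
Definition cl_has_sum (u : nat -> Cl) (s : Cl) : Prop :=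
  forall A, series (fun k => u k A) @ \oo --> s A.

Definition cl_sum (u : nat -> Cl) : Cl :=
  [ffun A => limn (series (fun k => u k A))].

Definition vec_part x : Cl := \sum_(l < n) x 0 (lift ord0 l) *: cl_gen l.

Definition paravector x : Cl := (x 0 0)%:A + vec_part x.

Definition real_point (t : R) : Pt := t *: delta_mx 0 0.

Definition rising (a : R) (s : nat) : R := \prod_(i < s) (a + i%:R).

Definition appell_coef (k s : nat) : R :=
  'C(k, s)%:R * (rising ((n%:R + 1) / 2) (k - s) * rising ((n%:R - 1) / 2) s)
  / rising n%:R k.

Definition appell (k : nat) x : Cl :=
  \sum_(s < k.+1) appell_coef k s *:
    (paravector x ^+ (k - s) * cl_conj (paravector x) ^+ s).

Definition fock_summable alpha : Prop :=
  cvgn (series (fun k => k`!%:R * cl_norm (alpha k) ^+ 2)).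

Definition fock_expansion f alpha : Prop :=
  fock_summable alpha /\ forall x, cl_has_sum (fun k => appell k x * alpha k) (f x).

Definition fock : set (Pt -> Cl) := [set f | exists alpha, fock_expansion f alpha].

(* The coefficients of f in fock are unique, as appell k (real_point t) = t^k.*)
Definition fock_coef f : nat -> Cl := xget (fun=> 0) [set alpha | fock_expansion f alpha].

Definition fock_inner f g : Cl :=
  cl_sum (fun k => k`!%:R *: (cl_conj (fock_coef f k) * fock_coef g k)).

Definition unit_vec (i : 'I_n.+1) : Pt := delta_mx 0 i.

Definition coord_fun f (A : {set 'I_n}) : Pt -> R := fun x => f x A.

Definition partial (i : 'I_n.+1) f : Pt -> Cl :=
  fun x => [ffun A => 'D_(unit_vec i) (coord_fun f A) x].

Definition class_C1 f : Prop := forall (i : 'I_n.+1) A,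
  (forall x, derivable (coord_fun f A) x (unit_vec i)) /\
  continuous ('D_(unit_vec i) (coord_fun f A)).

Definition vec_dirac f : Pt -> Cl :=
  fun x => \sum_(l < n) cl_gen l * partial (lift ord0 l) f x.

Definition monogenic f : Prop :=
  class_C1 f /\ forall x, partial ord0 f x + vec_dirac f x = 0.

(* On the real line, where vec_part x = 0, the second summand is 0, in        *)
(* accordance with B being odd.                                               *)
Definition axial_form f : Prop := exists A B : R -> R -> Cl,
  [/\ forall u v, A u (- v) = A u v,
      forall u v, B u (- v) = - B u v
    & forall x, let r := cl_norm (vec_part x) in
        f x = A (x 0 0) r + (r^-1 *: vec_part x) * B (x 0 0) r].

Definition axially_monogenic f : Prop := monogenic f /\ axial_form f.

Definition real_analytic (h : R -> Cl) : Prop :=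
  forall a, exists c : nat -> Cl, exists2 e : R, 0 < e &
    forall t, `|t - a| < e -> cl_has_sum (fun k => (t - a) ^+ k *: c k) (h t).

Definition is_gck (f0 : R -> Cl) F : Prop :=
  [/\ axially_monogenic F,
      exists h : nat -> R -> Cl, (forall j, real_analytic (h j)) /\
        forall x, cl_has_sum (fun j => vec_part x ^+ j * h j (x 0 0)) (F x)
    & forall t, F (real_point t) = f0 t].

(* GCK[f0] on the whole of R^(n+1), and 0 if there is no such extension.      *)
Definition gck (f0 : R -> Cl) : Pt -> Cl := xget (fun=> 0) [set F | is_gck f0 F].

Definition gck_mul F f : Pt -> Cl :=
  gck (fun t => F (real_point t) * f (real_point t)).

Definition creation f : Pt -> Cl := gck_mul (appell 1) f.

Definition annihilation f : Pt -> Cl :=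
  fun x => 2^-1 *: (partial ord0 f x - vec_dirac f x).

(* An unbounded operator on fock is a map T together with a domain D.         *)
Definition op_domain (T : (Pt -> Cl) -> Pt -> Cl) : set (Pt -> Cl) :=
  [set f | fock f /\ fock (T f)].

Definition op_graph (D : set (Pt -> Cl)) (T : (Pt -> Cl) -> Pt -> Cl) :
    set ((Pt -> Cl) * (Pt -> Cl)) :=
  [set p | D p.1 /\ p.2 = T p.1].

(* The pairs (f, h) with <h, g> = <f, T g> for all g in D; being the graph of a*)
(* map on a domain includes the uniqueness of h given f.                      *)
Definition adjoint_graph (D : set (Pt -> Cl)) (T : (Pt -> Cl) -> Pt -> Cl) :
    set ((Pt -> Cl) * (Pt -> Cl)) :=
  [set p | [/\ fock p.1, fock p.2
    & forall g, D g -> fock_inner p.2 g = fock_inner p.1 (T g)]].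

Lemma cl_conj_paravector x :
  cl_conj (paravector x) = (x 0 0)%:A - vec_part x.
Proof.
rewrite linearD /= cl_conj_scalar linear_sum -sumrN; congr (_ + _).
by apply: eq_bigr => l _; rewrite linearZ /= cl_conj_gen scalerN.
Qed.

Lemma appell1E x : (0 < n)%N -> appell 1 x =
  (2 * n%:R)^-1 *: ((n%:R + 1) *: paravector x
                    + (n%:R - 1) *: cl_conj (paravector x)).
Proof.
move=> n0; have nR : n%:R != 0 :> R by rewrite pnatr_eq0 -lt0n.
rewrite /appell big_ord_recr big_ord1 /= /appell_coef /rising.
rewrite !subn0 subnn !big_ord1 !big_ord0 !bin0 binn !addr0 !expr0 !expr1.
rewrite scalerDr !scalerA.
by congr (_ *: _ + _ *: _); rewrite ?mulr1 ?mul1r //; field; rewrite nR.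
Qed.

End Fock.

(* Main.v *)
Require Import Defs.
From mathcomp Require Import all_boot all_order all_algebra.
From mathcomp Require Import ring lra.
From mathcomp Require Import all_classical all_reals all_analysis.

(* On the real line P_k^n(t) = t^k, so f = sum_k P_k^n alpha_k has unique     *)
(* coefficients, the hypercomplex derivative acts on them by                  *)
(* alpha_k |-> (k + 1) alpha_(k+1) and, once GCK extensions are known to      *)
(* exist and to be unique, multiplication by P_1^n is the shift. With the     *)
(* weights k! these two operations are formal adjoints of each other, and     *)
(* testing against the polynomials P_m^n identifies the adjoint operators.    *)
(*                                                                            *)
(* P_k^n(x) = E_k + O_k (vec_part x) with real polynomials E_k, O_k in        *)
(* t = x_0 and p = |vec_part x|^2 given by a two-term linear recursion, from  *)
(* which all growth, Lipschitz and second-order estimates needed to           *)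
(* differentiate sum_k P_k^n alpha_k termwise are read off.                   *)
(*                                                                            *)
(* Uniqueness of GCK: if G = sum_j (vec_part x)^j h_j(x_0) is monogenic and   *)
(* h_0 = ... = h_j = 0, then at vec_part x = s e_1 one has G / s^j -> 0 for   *)
(* every x_0 as s -> 0, while its x_0-derivative converges to a nonzero       *)
(* multiple of e_1^j h_(j+1); a Baire argument shows that the limit vanishes. *)

Set Implicit Arguments.
Unset Strict Implicit.
Unset Printing Implicit Defensive.

Import Order.TTheory GRing.Theory Num.Theory.
Import numFieldNormedType.Exports.

Local Open Scope classical_set_scope.
Local Open Scope ring_scope.

(** In the basis [P_k^n] the two operators are those of the one-variable Fock space. The
    hypercomplex derivative sends the coefficients [alpha_k] to [(k + 1) alpha_(k+1)]
    ([annihilation_appell_sum]), and creation shifts them up by one degree ([creation_appell_sum]).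
    Since [k! (k + 1) = (k + 1)!] and the factors [k + 1] are real, each map is the transpose of the
    other for the weighted pairing ([fock_pairing_dcoefl], [fock_pairing_dcoefr]). This gives the
    pairing identity and one inclusion for each adjoint.

    For the other inclusions, a pair [(f, h)] in an adjoint graph is tested against the polynomials
    [P_m^n], which lie in both domains. Each test isolates one coefficient of [h]
    ([coef_eq_of_unit]), so [h] has exactly the coefficients that the formal adjoint assigns to [f].
    As [h] lies in the Fock space, these are summable, and this is the domain condition on [f].

    The analytic work is to justify the two coefficient formulas. With [b] the vector part of [x],
    [P_k^n = E_k + O_k b] ([appellE]), and monogenicity becomes a first-order system for the
    components ([ax_deriv_p]), which passes to the sums by termwise differentiation. For creation,
    the shifted series agrees on the real line with the product; it has to be a GCK extension of it
    ([appell_sum_is_gck], by regrouping in powers of [b]) and the only one ([is_gck_unique], from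
    [gck_vanish]). *)

Section EntireSequences.
Context {R : realType}.
Implicit Types (c u w : nat -> R) (k : nat).

(** * Coefficient sequences decaying faster than every geometric one *)

Definition entire c := forall r : R, 0 <= r -> exists M, forall k, `|c k| * r ^+ k <= M.

Lemma entire_bound c (r : R) : entire c -> 0 <= r ->
  exists2 M, 0 <= M & forall k, `|c k| * r ^+ k <= M.
Proof.
move=> /[apply] -[M cM]; exists M => //.
by apply: le_trans (cM 0); rewrite expr0 mulr1.
Qed.

Lemma entire_le c u (a s : R) : 0 <= s ->
  (forall k, `|u k| <= a * s ^+ k * `|c k|) -> entire c -> entire u.
Proof.
move=> s0 uc ec r r0; have [M M0 cM] := entire_bound ec (mulr_ge0 s0 r0).
exists (`|a| * M) => k; apply: (@le_trans _ _ (`|a| * s ^+ k * `|c k| * r ^+ k)).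
  apply: ler_wpM2r; first exact: exprn_ge0.
  apply: le_trans (uc k) _; rewrite !ler_wpM2r ?ler_norm ?exprn_ge0 //.
have -> : `|a| * s ^+ k * `|c k| * r ^+ k = `|a| * (`|c k| * (s * r) ^+ k).
  by rewrite exprMn; ring.
by rewrite ler_wpM2l.
Qed.

Lemma entireD c u : entire c -> entire u -> entire (fun k => c k + u k).
Proof.
move=> ec eu r r0; have [M cM] := ec r r0; have [N uN] := eu r r0.
exists (M + N) => k; apply: le_trans (lerD (cM k) (uN k)).
by rewrite -mulrDl ler_wpM2r ?exprn_ge0 ?ler_normD.
Qed.

Lemma entireZ (a : R) c : entire c -> entire (fun k => a * c k).
Proof.
apply: (@entire_le _ _ `|a| 1) => // k.
by rewrite expr1n mulr1 normrM.
Qed.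

Lemma entire0 : entire (fun=> 0).
Proof. by move=> r r0; exists 0 => k; rewrite normr0 mul0r. Qed.

Lemma entire_sum (I : Type) (s : seq I) (f : I -> nat -> R) :
  (forall i, entire (f i)) -> entire (fun k => \sum_(i <- s) f i k).
Proof.
move=> ef; elim: s => [|i s IH].
  by under eq_fun do rewrite big_nil; exact: entire0.
by under eq_fun do rewrite big_cons; exact: entireD.
Qed.

Lemma entire_shift c : entire c -> entire (fun k => c k.+1).
Proof.
move=> ec r r0; have [M cM] := ec (r + 1) (addr_ge0 r0 ler01).
exists M => k; apply: le_trans (cM k.+1).
rewrite ler_wpM2l // exprS; apply: (@le_trans _ _ ((r + 1) ^+ k)).
  by rewrite lerXn2r ?nnegrE ?addr_ge0 // lerDl.
by rewrite ler_peMl ?exprn_ge0 ?addr_ge0 // lerDr.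
Qed.

Lemma entire_shiftn c m : entire c -> entire (fun k => c (k + m)%N).
Proof.
elim: m c => [|m IH] c ec; first by under eq_fun do rewrite addn0.
by under eq_fun do rewrite addnS -addSn; exact: entire_shift (IH c ec).
Qed.

Lemma natr_le_exp2 k : k%:R <= 2 ^+ k :> R.
Proof. by rewrite -natrX ler_nat ltnW // ltn_expl. Qed.

Definition dcoef c : nat -> R := fun k => k.+1%:R * c k.+1.

Lemma entire_deriv c : entire c -> entire (dcoef c).
Proof.
move=> /entire_shift; apply: (@entire_le _ _ 2 2) => // k.
rewrite normrM ger0_norm ?ler_wpM2r // -exprS; exact: natr_le_exp2.
Qed.

Lemma entire_summable c (K : R) : entire c -> 0 <= K ->
  cvgn (series (fun k => K ^+ k * `|c k|)).
Proof.
move=> ec K0.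
(* The bound is taken at radius [2 * K], so that the terms at [K] are dominated by a geometric
   series of ratio 1/2. *)
have [M M0 cM] := entire_bound ec (mulr_ge0 (ler0n _ 2) K0).
apply: (@series_le_cvg _ _ (geometric M (1/2))).
- by move=> k; rewrite mulr_ge0 ?exprn_ge0.
- by move=> k; rewrite /= mulr_ge0 ?exprn_ge0.
- move=> k; rewrite /=.
  have := cM k; rewrite exprMn => h.
  have e : K ^+ k * `|c k| = `|c k| * (2 ^+ k * K ^+ k) * (1/2) ^+ k.
    rewrite div1r exprVn; field; by rewrite expf_neq0.
  by rewrite e ler_wpM2r // exprn_ge0.
- by apply: is_cvg_geometric_series; rewrite ger0_norm; lra.
Qed.

(** [M] is the sum of [K ^+ k * |c k|]. It is fixed before the weights [w], so one constant serves a
    whole family of differences or remainders; this uniformity replaces uniform convergence in the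
    termwise estimates. *)
Lemma entire_sum_bound c (K : R) : entire c -> 0 <= K ->
  exists2 M, 0 <= M & forall w (C : R), (forall k, `|w k| <= C * K ^+ k) ->
    cvgn (series (fun k => w k * c k)) /\
    `|limn (series (fun k => w k * c k))| <= C * M.
Proof.
move=> ec K0; have cv := entire_summable ec K0.
exists (limn (series (fun k => K ^+ k * `|c k|))).
  rewrite limr_ge //; near=> m.
  by rewrite /series /= sumr_ge0 // => k _; rewrite mulr_ge0 ?exprn_ge0.
move=> w C wC.
have C0 : 0 <= C by have := wC 0; rewrite expr0 mulr1; exact: le_trans.
have le1 k : `|w k * c k| <= C * (K ^+ k * `|c k|).
  by rewrite normrM mulrA ler_wpM2r.
have cvC : cvgn (series (fun k => C * (K ^+ k * `|c k|))).
  exact: (@is_cvg_seriesZ _ (fun k => K ^+ k * `|c k|) C).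
have cvn : cvgn [normed series (fun k => w k * c k)].
  apply: series_le_cvg le1 cvC => k //.
  by rewrite !mulr_ge0 ?exprn_ge0.
split; first exact: normed_cvg.
apply: le_trans (lim_series_norm cvn) _.
apply: le_trans (lim_series_le cvn cvC le1) _.
by rewrite (@lim_seriesZ _ (fun k => K ^+ k * `|c k|) C cv).
Unshelve. all: by end_near. Qed.

Lemma entire_cvg c w (C K : R) : entire c -> 0 <= K ->
  (forall k, `|w k| <= C * K ^+ k) -> cvgn (series (fun k => w k * c k)).
Proof.
by move=> ec /(entire_sum_bound ec)[M _ cM] /cM[].
Qed.

Lemma series_shift0 (u : nat -> R) (l : R) : u 0 = 0 ->
  (series (fun k => u k.+1) @ \oo --> l) <-> (series u @ \oo --> l).
Proof.
move=> u0; rewrite -[in X in _ <-> X]cvg_shiftS.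
suff -> : series (fun k => u k.+1) = [sequence series u m.+1]_m by [].
by rewrite funeqE => m; rewrite /series /= big_nat_recl //= u0 add0r.
Qed.

End EntireSequences.

(** * Derivatives from quadratic remainders, and limits of derivatives *)

Section Derivatives.
Context {R : realType}.

Lemma is_derive_quadratic (V : normedModType R) (x v : V) (f : V -> R) (l C : R) :
  (forall h : R, `|h| <= 1 -> `|f (h *: v + x) - f x - h * l| <= h ^+ 2 * C) ->
  is_derive x v f l.
Proof.
move=> fl.
have C0 : 0 <= C.
  by have := fl 1; rewrite normr1 expr1n !mul1r => /(_ (lexx _)) /(le_trans (normr_ge0 _)).
suff H : (fun h : R => h^-1 *: (f (h *: v + x) - f x)) @ 0^' --> l.
  split; first by apply/cvg_ex; exists l.
  exact: cvg_lim H.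
apply/cvgrPdist_le => e e0.
near=> h.
have h0 : h != 0 by near: h; exact: nbhs_dnbhs_neq.
have -> : l - h^-1 *: (f (h *: v + x) - f x)
   = - (h^-1 * (f (h *: v + x) - f x - h * l)).
  by rewrite /GRing.scale /= [in RHS]mulrBr mulKf // opprB.
rewrite normrN normrM normfV mulrC ler_pdivrMr ?normr_gt0 //.
have h1 : `|h| <= 1.
  near: h; apply: dnbhs0_le; exact: ltr01.
apply: le_trans (fl h h1) _.
rewrite -real_normK ?num_real // expr2 -mulrA mulrC ler_pM2r ?normr_gt0 //.
rewrite mulrC; apply: (@le_trans _ _ ((C + 1) * `|h|)).
  by rewrite ler_wpM2r // lerDl.
rewrite mulrC -ler_pdivlMr; last by lra.
near: h; apply: dnbhs0_le; apply: divr_gt0 => //; lra.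
Unshelve. all: by end_near. Qed.

Lemma is_derive_line (V : normedModType R) (x v : V) (f : V -> R) (l : R) :
  is_derive x v f l <-> is_derive (0 : R) 1 (fun h : R => f (h *: v + x)) l.
Proof.
have e : (fun h : R => h^-1 *: (f ((h *: (1 : R) + 0) *: v + x) - f (0 *: v + x)))
   = (fun h : R => h^-1 *: (f (h *: v + x) - f x)).
  by apply/funext => h; rewrite addr0 (_ : h *: 1 = h) ?scale0r ?add0r //; exact: mulr1.
split=> -[d dl]; split.
- by rewrite /derivable e.
- by rewrite /derive e.
- by move: d; rewrite /derivable e.
- by move: dl; rewrite /derive e.
Qed.

(* A Baire argument: pointwise convergence of the derivatives is enough,      *)
(* because it is uniform on some interval.                                    *)
Lemma derive_limit_le0 (u du : nat -> R -> R) (phi : R -> R) :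
  (forall (m : nat) (t : R), is_derive t (1 : R) (u m) (du m t)) ->
  (forall m, continuous (du m)) -> continuous phi ->
  (forall t, (fun m => u m t) @ \oo --> 0) ->
  (forall t, (fun m => du m t) @ \oo --> phi t) ->
  forall t, phi t <= 0.
Proof.
move=> udu cdu cphi u0 duphi t0; rewrite leNgt; apply/negP => pt0.
pose e := phi t0 / 2.
have e0 : 0 < e by rewrite divr_gt0.
have ept : e < phi t0 by rewrite /e; lra.
have [d d0 dphi] : exists2 d : R, 0 < d & forall t, `|t - t0| < d -> e < phi t.
  have : \forall t \near t0, e < phi t.
    exact: (cvgr_gt _ (cphi t0)).
  move=> /nbhs_ballP[d /= d0 H]; exists d => // t td; apply: H.
  by rewrite /ball /= distrC.
(* The points far from [t0] are included so that density of every [F M] would be contradicted by a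
   single point close to [t0]. *)
pose F M := [set t | d / 2 < `|t - t0|] `|`
            \bigcup_m [set t | (M <= m)%N /\ du m t < e].
have oF M : open (F M).
  apply: openU.
    rewrite (_ : [set _ | _] = (fun t => `|t - t0|) @^-1` [set y | d / 2 < y]) //.
    apply: open_comp; last exact: open_gt.
    move=> t _; apply: cvg_norm; apply: cvgB; [exact: cvg_id|exact: cvg_cst].
  apply: bigcup_open => m _.
  have [Mm|Mm] := boolP (M <= m)%N; last first.
    rewrite (_ : [set _ | _] = set0) ?open0 //.
    by apply/seteqP; split=> // x [].
  rewrite (_ : [set _ | _] = du m @^-1` [set y | y < e]); last first.
    by apply/seteqP; split=> x // [].
  by apply: open_comp; [move=> x _; exact: cdu|exact: open_lt].
(* Otherwise Baire yields a point [t] near [t0] in all the [F M]: there [du m t < e] for arbitrarily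
   large [m], although [du m t] tends to [phi t > e]. *)
have [M nF] : exists M, ~ dense (F M).
  apply: contrapT => /forallNP H.
  have /(Baire (U := R)) D : forall M, open (F M) /\ dense (F M).
    by move=> M; split=> //; apply: contrapT; exact: H.
  have d2 : 0 < d / 2 by rewrite divr_gt0.
  have [] := D (ball t0 (d / 2)).
  - by exists t0; exact: ballxx.
  - exact: ball_open.
  - move=> t; rewrite /ball /= distrC => -[td tF].
    have : e < phi t by apply: dphi; lra.
    rewrite ltNge => /negP; apply; rewrite leNgt; apply/negP => pt.
    have [N _ NP] : \forall m \near \oo, e < du m t.
      exact: (cvgr_gt _ (duphi t)).
    case: (tF N I) => [/=|[m _ [Nm]]]; first by rewrite ltNge (ltW td).
    by rewrite ltNge (ltW (NP m Nm)).
have [U [[x [oU Ux]] UF]] := denseNE nF.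
have duU t m : U t -> (M <= m)%N -> e <= du m t.
  move=> Ut Mm; rewrite leNgt; apply/negP => h.
  have : (U `&` F M) t by split=> //; right; exists m.
  by rewrite UF.
have := oU; rewrite openE => /(_ x Ux); move=> /nbhs_ballP[r /= r0 rU].
have Uab t : x <= t <= x + r / 2 -> U t.
  by move=> xt; apply: rU; rewrite /ball /= ler0_norm; lra.
have xr : x < x + r / 2 by lra.
(* On [[x, x + r / 2]], which lies in [U], every late [u m] has slope at least [e]; its increment
   tends to 0 and yet stays above [e * (r / 2)]. *)
have : e * (r / 2) <= 0.
  have cv : (fun m => u m (x + r / 2) - u m x) @ \oo --> (0 : R).
    by rewrite -[X in _ --> X](subrr 0); apply: cvgB; exact: u0.
  rewrite -[leRHS](cvg_lim (@Rhausdorff R) cv).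
  apply: limr_ge; first by apply/cvg_ex; exists 0.
  near=> m.
  have cum : {within `[x, x + r / 2], continuous (u m)}.
    apply: derivable_within_continuous => y _.
    by have [] := udu m y.
  have [c] := MVT xr (fun y _ => udu m y) cum.
  rewrite in_itv /= => /andP[xc cx] ->.
  rewrite addrAC subrr add0r ler_wpM2r //; first by lra.
  apply: duU; first by apply: Uab; rewrite !ltW.
  by near: m; exists M.
by rewrite leNgt mulr_gt0 //; lra.
Unshelve. all: by end_near. Qed.
End Derivatives.

(** * The real components of the Appell polynomials and their estimates *)

Section AxialComponents.
Context {R : realType} (n : nat).
Implicit Types (t p h K : R) (k : nat).

(** The recursion of [ax_pair] is left multiplication by the paravector, with the new vector
    component damped by this factor. The factor arises by solving the linear system of
    [axial_system]; it equals 1 for [n = 1]. *)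
Definition odd_weight k : R := k.+1%:R / (k + n)%:R.

(* appell k x = axE t p k + axO t p k * vec_part x, where t = x_0 and p is    *)
(* the square of |vec_part x|; see appellE.                                   *)
Fixpoint ax_pair t p k : R * R :=
  if k is k'.+1 then
    let eo := ax_pair t p k' in
    (t * eo.1 - p * eo.2, odd_weight k' * (t * eo.2 + eo.1))
  else (1, 0).

Definition axE t p k := (ax_pair t p k).1.
Definition axO t p k := (ax_pair t p k).2.

Fixpoint ax_dpair t p k : R * R :=
  if k is k'.+1 then
    let vw := ax_dpair t p k' in
    (t * vw.1 - p * vw.2 - axO t p k', odd_weight k' * (t * vw.2 + vw.1))
  else (0, 0).

(* d/dp of axE t p k and axO t p k: the recursion of ax_pair differentiated.  *)
Definition axV t p k := (ax_dpair t p k).1.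
Definition axW t p k := (ax_dpair t p k).2.

Lemma axE0 t p : axE t p 0 = 1. Proof. by []. Qed.
Lemma axO0 t p : axO t p 0 = 0. Proof. by []. Qed.
Lemma axES t p k : axE t p k.+1 = t * axE t p k - p * axO t p k.
Proof. by []. Qed.
Lemma axOS t p k : axO t p k.+1 = odd_weight k * (t * axO t p k + axE t p k).
Proof. by []. Qed.
Lemma axVS t p k : axV t p k.+1 = t * axV t p k - p * axW t p k - axO t p k.
Proof. by []. Qed.
Lemma axWS t p k : axW t p k.+1 = odd_weight k * (t * axW t p k + axV t p k).
Proof. by []. Qed.

Lemma axE_real t k : axE t 0 k = t ^+ k.
Proof. by elim: k => // k IH; rewrite axES IH mul0r subr0 exprS. Qed.

Hypothesis n_gt0 : (0 < n)%N.

Lemma odd_weight_itv k : 0 <= odd_weight k <= 1.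
Proof.
rewrite /odd_weight divr_ge0 //= ler_pdivrMr ?ltr0n ?addn_gt0 ?n_gt0 ?orbT //.
by rewrite mul1r ler_nat -addn1 leq_add2l.
Qed.

Lemma odd_weightK k : (k + n)%:R * odd_weight k = k.+1%:R.
Proof.
by rewrite /odd_weight mulrC divfK // pnatr_eq0 addn_eq0 negb_and -!lt0n n_gt0 orbT.
Qed.

Lemma odd_weight_inj k (a b : R) : (k + n)%:R * a = k.+1%:R * b -> a = odd_weight k * b.
Proof.
move=> e; apply: (@mulfI _ (k + n)%:R).
  by rewrite pnatr_eq0 addn_eq0 negb_and -!lt0n n_gt0 orbT.
by rewrite e mulrA odd_weightK.
Qed.

(** The Appell property in algebraic form: [k * axE t p k.-1] and [k * axO t p k.-1] satisfy the
    recursion of [ax_pair] differentiated in [t], hence play the role of the [t]-derivatives in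
    [ax_quadratic_t]. *)
Lemma ax_deriv_t t p k :
  k.+1%:R * axE t p k = axE t p k
     + t * (k%:R * axE t p k.-1) - p * (k%:R * axO t p k.-1) /\
  k.+1%:R * axO t p k = odd_weight k * (axO t p k
     + t * (k%:R * axO t p k.-1) + k%:R * axE t p k.-1).
Proof.
case: k => [|k] /=.
  by rewrite axO0 axE0; split; ring.
split; first by rewrite [in RHS]axES -[in LHS]natr1 axES; ring.
apply: odd_weight_inj.
have -> : axO t p k.+1 + t * (k.+1%:R * axO t p k) + k.+1%:R * axE t p k
  = (k.+1 + n)%:R * axO t p k.+1.
  rewrite -addrA mulrCA -mulrDr -(odd_weightK k) -mulrA -axOS.
  by rewrite addSn -[(k + n).+1%:R]natr1; ring.
ring.
Qed.

(** Monogenicity of [E + O b] in algebraic form. In the variables [t = x_0] and [p = |b|^2] it is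
    the system [2 dE/dp = - dO/dt], [dE/dt = n O + 2 p dO/dp], where the [t]-derivatives lower the
    degree and bring out the factor [k]. The two equations are proved together because the induction
    mixes them. *)
Lemma ax_deriv_p t p k :
  axV t p k = - (k%:R / 2) * axO t p k.-1 /\
  k%:R * axE t p k.-1 = n%:R * axO t p k + 2 * p * axW t p k.
Proof.
elim: k => [|k [IHV IHW]].
  by rewrite /axV /axW /= !(mul0r, mulr0, oppr0, addr0).
have pW : p * axW t p k = (k%:R * axE t p k.-1 - n%:R * axO t p k) / 2.
  by rewrite IHW; field.
have kO : k%:R * (t * axO t p k.-1 + axE t p k.-1) = (k%:R + n%:R - 1) * axO t p k.
  case: (k) => [|j]; first by rewrite /= axO0; ring.
  rewrite /= -[in LHS]odd_weightK -mulrA -axOS natrD -natr1; ring.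
split.
  rewrite axVS pW IHV /=.
  have -> : t * (- (k%:R / 2) * axO t p k.-1)
      - (k%:R * axE t p k.-1 - n%:R * axO t p k) / 2 - axO t p k =
      - (k%:R * (t * axO t p k.-1 + axE t p k.-1)) / 2 + (n%:R / 2 - 1) * axO t p k
    by field.
  by rewrite kO -natr1; field.
rewrite axOS axWS /=.
have -> : n%:R * (odd_weight k * (t * axO t p k + axE t p k))
    + 2 * p * (odd_weight k * (t * axW t p k + axV t p k))
  = odd_weight k * (n%:R * (t * axO t p k + axE t p k)
    + 2 * t * (p * axW t p k) + 2 * p * axV t p k) by ring.
apply: odd_weight_inj; rewrite pW IHV.
have -> : k.+1%:R *
  (n%:R * (t * axO t p k + axE t p k) +
   2 * t * ((k%:R * axE t p k.-1 - n%:R * axO t p k) / 2) +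
   2 * p * (- (k%:R / 2) * axO t p k.-1))
  = k.+1%:R * (n%:R * axE t p k + k%:R * (t * axE t p k.-1 - p * axO t p k.-1)).
  by field.
have -> : k%:R * (t * axE t p k.-1 - p * axO t p k.-1) = k%:R * axE t p k.
  by case: (k) => [|j] //; rewrite !mul0r.
rewrite natrD; ring.
Qed.

(* Common source of the growth, Lipschitz and second-order estimates below:   *)
(* differences and remainders satisfy the recursion of ax_pair up to a        *)
(* forcing term.                                                              *)
Lemma forced_bound t p K (A : R) (X Y f g : nat -> R) : `|t| + `|p| + 2 <= K ->
  `|X 0| <= A -> `|Y 0| <= A ->
  (forall k, X k.+1 = t * X k - p * Y k + f k) ->
  (forall k, Y k.+1 = odd_weight k * (t * Y k + X k + g k)) ->
  (forall k, `|f k| <= 2 * A * K ^+ k) -> (forall k, `|g k| <= A * K ^+ k) ->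
  forall k, `|X k| <= A * K ^+ k /\ `|Y k| <= A * K ^+ k.
Proof.
move=> tpK X0 Y0 XS YS fA gA.
have A0 : 0 <= A by apply: le_trans X0.
have K0 : 0 <= K by apply: le_trans tpK; rewrite !addr_ge0.
elim=> [|k [IHX IHY]]; first by rewrite expr0 mulr1.
set B := A * K ^+ k in IHX IHY *.
have -> : A * K ^+ k.+1 = B * K by rewrite exprSr mulrA.
have B0 : 0 <= B by rewrite mulr_ge0 ?exprn_ge0.
have fB : `|f k| <= 2 * B by rewrite mulrA.
have tX : `|t * X k| <= `|t| * B by rewrite normrM ler_wpM2l.
have tY : `|t * Y k| <= `|t| * B by rewrite normrM ler_wpM2l.
have pY : `|p * Y k| <= `|p| * B by rewrite normrM ler_wpM2l.
(* The summand 2 in the lower bound for [K] pays for [f k] in the first component, and for [X k] and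
   [g k] together in the second. *)
have BK : (`|t| + `|p| + 2) * B <= B * K by rewrite [leRHS]mulrC ler_wpM2r.
have pB : 0 <= `|p| * B by rewrite mulr_ge0.
split.
  rewrite XS; apply: le_trans (ler_normD _ _) _.
  have := ler_normB (t * X k) (p * Y k); lra.
have [w0 w1] := andP (odd_weight_itv k).
rewrite YS normrM ger0_norm //; apply: le_trans (ler_piMl _ w1) _ => //.
apply: le_trans (ler_normD _ _) _.
have := ler_normD (t * Y k) (X k); have := gA k; rewrite -/B; lra.
Qed.

Lemma ax_bound t p K k : `|t| + `|p| + 2 <= K ->
  `|axE t p k| <= K ^+ k /\ `|axO t p k| <= K ^+ k.
Proof.
move=> tpK; rewrite -[K ^+ k]mul1r; move: k.
apply: (forced_bound tpK (f := fun=> 0) (g := fun=> 0)) => [||k|k|k|k].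
- by rewrite axE0 normr1.
- by rewrite axO0 normr0.
- by rewrite addr0.
- by rewrite addr0.
- rewrite normr0 !mulr_ge0 ?exprn_ge0 //.
  by apply: le_trans tpK; rewrite !addr_ge0.
- rewrite normr0 mul1r exprn_ge0 //.
  by apply: le_trans tpK; rewrite !addr_ge0.
Qed.

Lemma ax_dbound t p K k : `|t| + `|p| + 2 <= K ->
  `|axV t p k| <= K ^+ k /\ `|axW t p k| <= K ^+ k.
Proof.
move=> tpK; rewrite -[K ^+ k]mul1r; move: k.
have K0 : 0 <= K by apply: le_trans tpK; rewrite !addr_ge0.
apply: (forced_bound tpK (f := fun k => - axO t p k) (g := fun=> 0)) => [||k|k|k|k].
- by rewrite normr0.
- by rewrite normr0.
- by rewrite axVS.
- by rewrite addr0.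
- rewrite normrN mulr1; apply: le_trans (proj2 (ax_bound k tpK)) _.
  by rewrite ler_peMl ?exprn_ge0 ?ler1n.
- by rewrite normr0 mul1r exprn_ge0.
Qed.

Lemma ax_lipschitz t p t' p' K k :
  `|t| + `|p| + 2 <= K -> `|t'| + `|p'| + 2 <= K ->
  let d := `|t - t'| + `|p - p'| in
  `|axE t p k - axE t' p' k| <= d * K ^+ k /\
  `|axO t p k - axO t' p' k| <= d * K ^+ k.
Proof.
move=> tpK tpK' d; move: k.
have K0 : 0 <= K by apply: le_trans tpK; rewrite !addr_ge0.
have d0 : 0 <= d by rewrite addr_ge0.
have td : `|t - t'| <= d by rewrite lerDl.
(* The difference obeys the recursion at [(t, p)]; the forcing is the change of the coefficients [t]
   and [p] times the values at [(t', p')]. *)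
apply: (forced_bound tpK
  (f := fun k => (t - t') * axE t' p' k - (p - p') * axO t' p' k)
  (g := fun k => (t - t') * axO t' p' k)) => [||k|k|k|k].
- by rewrite !axE0 subrr normr0.
- by rewrite !axO0 subrr normr0.
- rewrite !axES; ring.
- rewrite !axOS; ring.
- have [bE bO] := ax_bound k tpK'.
  apply: le_trans (ler_normB _ _) _; rewrite !normrM.
  apply: (@le_trans _ _ (d * K ^+ k)).
    by rewrite mulrDl lerD // ler_wpM2l.
  by rewrite -mulrA ler_peMl ?ler1n // mulr_ge0 ?exprn_ge0.
- have [bE bO] := ax_bound k tpK'.
  by rewrite normrM ler_pM.
Qed.

Lemma ax_dlipschitz t p t' p' K k :
  `|t| + `|p| + 2 <= K -> `|t'| + `|p'| + 2 <= K ->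
  let d := `|t - t'| + `|p - p'| in
  `|axV t p k - axV t' p' k| <= d * K ^+ k /\
  `|axW t p k - axW t' p' k| <= d * K ^+ k.
Proof.
move=> tpK tpK' d; move: k.
have K0 : 0 <= K by apply: le_trans tpK; rewrite !addr_ge0.
have d0 : 0 <= d by rewrite addr_ge0.
have td : `|t - t'| <= d by rewrite lerDl.
apply: (forced_bound tpK
  (f := fun k => (t - t') * axV t' p' k - (p - p') * axW t' p' k
                 - (axO t p k - axO t' p' k))
  (g := fun k => (t - t') * axW t' p' k)) => [||k|k|k|k].
- by rewrite subrr normr0.
- by rewrite subrr normr0.
- rewrite !axVS; ring.
- rewrite !axWS; ring.
- have [bV bW] := ax_dbound k tpK'; have [_ lO] := ax_lipschitz k tpK tpK'.
  apply: le_trans (ler_normB _ _) _.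
  rewrite -mulrA mulr_natl mulr2n lerD //.
  apply: le_trans (ler_normB _ _) _; rewrite !normrM.
  by rewrite mulrDl lerD // ler_wpM2l.
- have [bV bW] := ax_dbound k tpK'.
  by rewrite normrM ler_pM.
Qed.

(** The remainder obeys the recursion with forcing [h] times a first difference; the latter is of
    order [h] by [ax_lipschitz]. The summand 3 instead of 2 leaves room for moving [t] by at most
    1. *)
Lemma ax_quadratic_t t p h K k : `|t| + `|p| + 3 <= K -> `|h| <= 1 ->
  `|axE (t + h) p k - axE t p k - h * (k%:R * axE t p k.-1)| <= h ^+ 2 * K ^+ k /\
  `|axO (t + h) p k - axO t p k - h * (k%:R * axO t p k.-1)| <= h ^+ 2 * K ^+ k.
Proof.
move=> tpK h1; move: k.
have tpK2 : `|t| + `|p| + 2 <= K by lra.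
have tpK' : `|t + h| + `|p| + 2 <= K by have := ler_normD t h; lra.
have K0 : 0 <= K by apply: le_trans tpK; rewrite !addr_ge0.
have L k := ax_lipschitz k tpK' tpK2.
have hh : `|h| * `|h| = h ^+ 2 by rewrite -normrM -expr2 ger0_norm ?sqr_ge0.
apply: (forced_bound tpK2
  (f := fun k => h * (axE (t + h) p k - axE t p k))
  (g := fun k => h * (axO (t + h) p k - axO t p k))) => [||k|k|k|k].
- by rewrite !axE0 mul0r mulr0 subrr subr0 normr0 sqr_ge0.
- by rewrite !axO0 !mulr0 !subrr normr0 sqr_ge0.
- rewrite !axES /= (proj1 (ax_deriv_t t p k)); ring.
- rewrite !axOS /= (proj2 (ax_deriv_t t p k)); ring.
- rewrite normrM -mulrA; have [+ _] := L k.
  rewrite addrAC subrr add0r subrr normr0 addr0 => LE.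
  apply: (@le_trans _ _ (h ^+ 2 * K ^+ k)).
    by rewrite -hh -mulrA ler_wpM2l.
  by rewrite ler_peMl ?ler1n // mulr_ge0 ?sqr_ge0 ?exprn_ge0.
- rewrite normrM; have [_] := L k.
  rewrite addrAC subrr add0r subrr normr0 addr0 => LO.
  by rewrite -hh -mulrA ler_wpM2l.
Qed.

Lemma ax_quadratic_p t p h K k : `|t| + `|p| + 3 <= K -> `|h| <= 1 ->
  `|axE t (p + h) k - axE t p k - h * axV t p k| <= h ^+ 2 * K ^+ k /\
  `|axO t (p + h) k - axO t p k - h * axW t p k| <= h ^+ 2 * K ^+ k.
Proof.
move=> tpK h1; move: k.
have tpK2 : `|t| + `|p| + 2 <= K by lra.
have tpK' : `|t| + `|p + h| + 2 <= K by have := ler_normD p h; lra.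
have K0 : 0 <= K by apply: le_trans tpK; rewrite !addr_ge0.
have L k := ax_lipschitz k tpK' tpK2.
have hh : `|h| * `|h| = h ^+ 2 by rewrite -normrM -expr2 ger0_norm ?sqr_ge0.
apply: (forced_bound tpK2
  (f := fun k => - h * (axO t (p + h) k - axO t p k))
  (g := fun k => 0)) => [||k|k|k|k].
- by rewrite !axE0 mulr0 subrr subr0 normr0 sqr_ge0.
- by rewrite !axO0 mulr0 !subrr normr0 sqr_ge0.
- rewrite !axES axVS; ring.
- rewrite !axOS axWS; ring.
- rewrite normrM normrN -mulrA; have [_] := L k.
  rewrite [p + h]addrC -addrA !subrr !normr0 add0r addr0 => LO.
  apply: (@le_trans _ _ (h ^+ 2 * K ^+ k)).
    by rewrite -hh -mulrA ler_wpM2l // [p + h]addrC.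
  by rewrite ler_peMl ?ler1n // mulr_ge0 ?sqr_ge0 ?exprn_ge0.
- by rewrite normr0 mulr_ge0 ?sqr_ge0 ?exprn_ge0.
Qed.

End AxialComponents.

(** * Termwise estimates for series with entire coefficients *)

Section WeightedSums.
Context {R : realType}.
Implicit Types (c w f g d : nat -> R) (h K : R) (k : nat).

Definition wsum w c : R := limn (series (fun k => w k * c k)).

Lemma series_cvgD (f g : nat -> R) (a b : R) :
  series f @ \oo --> a -> series g @ \oo --> b ->
  series (fun k => f k + g k) @ \oo --> a + b.
Proof.
move=> fa gb; rewrite (_ : series _ = series f \+ series g); first exact: cvgD.
by apply/funext => m; rewrite /series /= big_split.
Qed.

Lemma series_cvgZ (z : R) (f : nat -> R) (a : R) :
  series f @ \oo --> a -> series (fun k => z * f k) @ \oo --> z * a.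
Proof.
move=> fa; rewrite (_ : series _ = (fun m => z * series f m)).
  exact: (cvgM (cvg_cst z) fa).
by apply/funext => m; rewrite /series /= mulr_sumr.
Qed.

Lemma wsum_cvg w c : cvgn (series (fun k => w k * c k)) ->
  series (fun k => w k * c k) @ \oo --> wsum w c.
Proof. by []. Qed.

Lemma wsumE w c (s : R) : series (fun k => w k * c k) @ \oo --> s -> wsum w c = s.
Proof. exact: cvg_lim. Qed.

Lemma wsum_lipschitz c K : entire c -> 0 <= K -> exists2 C, 0 <= C &
  forall f g (e : R), (forall k, `|f k| <= K ^+ k) -> (forall k, `|g k| <= K ^+ k) ->
  (forall k, `|f k - g k| <= e * K ^+ k) -> `|wsum f c - wsum g c| <= e * C.
Proof.
move=> ec K0; have [C C0 cC] := entire_sum_bound ec K0; exists C => // f g e fK gK fge.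
have cf : cvgn (series (fun k => f k * c k)).
  by apply: (@entire_cvg _ _ _ 1 K) => // k; rewrite mul1r.
have cg : cvgn (series (fun k => g k * c k)).
  by apply: (@entire_cvg _ _ _ 1 K) => // k; rewrite mul1r.
have [_] := cC _ _ fge.
rewrite -/(wsum (fun k => f k - g k) c) (_ : wsum _ c = wsum f c - wsum g c) //.
apply: wsumE; have := series_cvgD (wsum_cvg cf) (@series_cvgZ (-1) _ _ (wsum_cvg cg)).
rewrite mulN1r; under eq_fun do rewrite mulN1r -mulrBl; exact.
Qed.

Lemma wsum_quadratic c K : entire c -> 0 <= K -> exists C,
  forall f g d h, (forall k, `|f k| <= K ^+ k) -> (forall k, `|g k| <= K ^+ k) ->
  cvgn (series (fun k => d k * c k)) ->
  (forall k, `|f k - g k - h * d k| <= h ^+ 2 * K ^+ k) ->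
  `|wsum f c - wsum g c - h * wsum d c| <= h ^+ 2 * C.
Proof.
move=> ec K0; have [C C0 cC] := entire_sum_bound ec K0; exists C => f g d h fK gK cd fgd.
have cf : cvgn (series (fun k => f k * c k)).
  by apply: (@entire_cvg _ _ _ 1 K) => // k; rewrite mul1r.
have cg : cvgn (series (fun k => g k * c k)).
  by apply: (@entire_cvg _ _ _ 1 K) => // k; rewrite mul1r.
have [_] := cC _ _ fgd.
rewrite -/(wsum (fun k => f k - g k - h * d k) c).
rewrite (_ : wsum _ c = wsum f c - wsum g c - h * wsum d c) //.
apply: wsumE; have := series_cvgD (series_cvgD (wsum_cvg cf)
  (@series_cvgZ (-1) _ _ (wsum_cvg cg))) (@series_cvgZ (- h) _ _ (wsum_cvg cd)).
rewrite mulN1r mulNr; under eq_fun do rewrite mulN1r mulNr mulrA -!mulrBl; exact.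
Qed.

(** Summation by index shift: the derivative is moved from the basis functions, where it is
    [k * f k.-1], to the coefficients. The term [k = 0] is killed by its factor, so the value of
    [0.-1] does not matter. *)
Lemma wsum_deriv f c :
  cvgn (series (fun k => f k * dcoef c k)) ->
  series (fun k => k%:R * f k.-1 * c k) @ \oo --> wsum f (dcoef c).
Proof.
move=> cf; apply/series_shift0; first by rewrite !mul0r.
have := wsum_cvg cf.
by under eq_fun do rewrite /dcoef mulrCA mulrA.
Qed.

Lemma wsumDr w c c' : cvgn (series (fun k => w k * c k)) ->
  cvgn (series (fun k => w k * c' k)) ->
  wsum w (fun k => c k + c' k) = wsum w c + wsum w c'.
Proof.
move=> cw cw'; apply: wsumE; under eq_fun do rewrite mulrDr.
exact: series_cvgD.
Qed.

End WeightedSums.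
Arguments series_cvgZ {R} z {f a}.

(** * Differentiability and continuity of the summed components *)

Section AxialSeries.
Context {R : realType} (n : nat).
Hypothesis n_gt0 : (0 < n)%N.
Implicit Types (c : nat -> R) (t p h K : R) (k : nat).

Definition sumE c t p := wsum (axE n t p) c.
Definition sumO c t p := wsum (axO n t p) c.
Definition sumW c t p := wsum (axW n t p) c.

Let box t p := `|t| + `|p| + 3.

Let box_ge0 t p : 0 <= box t p. Proof. by rewrite !addr_ge0. Qed.

Let box_ge t p : `|t| + `|p| + 2 <= box t p. Proof. by rewrite /box; lra. Qed.

Lemma sumE_cvg c t p : entire c ->
  series (fun k => axE n t p k * c k) @ \oo --> sumE c t p.
Proof.
move=> ec; apply: wsum_cvg; apply: (@entire_cvg _ _ _ 1) ec (box_ge0 t p) _ => k.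
by rewrite mul1r; have [] := ax_bound n_gt0 k (box_ge t p).
Qed.

Lemma sumO_cvg c t p : entire c ->
  series (fun k => axO n t p k * c k) @ \oo --> sumO c t p.
Proof.
move=> ec; apply: wsum_cvg; apply: (@entire_cvg _ _ _ 1) ec (box_ge0 t p) _ => k.
by rewrite mul1r; have [] := ax_bound n_gt0 k (box_ge t p).
Qed.

Lemma sumW_cvg c t p : entire c ->
  series (fun k => axW n t p k * c k) @ \oo --> sumW c t p.
Proof.
move=> ec; apply: wsum_cvg; apply: (@entire_cvg _ _ _ 1) ec (box_ge0 t p) _ => k.
by rewrite mul1r; have [] := ax_dbound n_gt0 k (box_ge t p).
Qed.

Lemma sumE_derive_t c t p : entire c ->
  is_derive t (1 : R) (fun s => sumE c s p) (sumE (dcoef c) t p).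
Proof.
move=> ec; have [C HC] := wsum_quadratic ec (box_ge0 t p).
have cd := wsum_deriv (cvgP _ (@sumE_cvg _ t p (entire_deriv ec))).
apply: (@is_derive_quadratic _ _ _ _ _ _ C) => h h1.
rewrite -[sumE (dcoef c) t p](wsumE cd) /= [h *: (1 : R)]mulr1 [h + t]addrC.
have box' : `|t + h| + `|p| + 2 <= box t p.
  by rewrite /box; have := ler_normD t h; lra.
apply: HC => [k|k||k].
- by have [] := ax_bound n_gt0 k box'.
- by have [] := ax_bound n_gt0 k (box_ge t p).
- exact: cvgP cd.
- by have [] := ax_quadratic_t n_gt0 k (lexx (box t p)) h1.
Qed.

Lemma sumO_derive_t c t p : entire c ->
  is_derive t (1 : R) (fun s => sumO c s p) (sumO (dcoef c) t p).
Proof.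
move=> ec; have [C HC] := wsum_quadratic ec (box_ge0 t p).
have cd := wsum_deriv (cvgP _ (@sumO_cvg _ t p (entire_deriv ec))).
apply: (@is_derive_quadratic _ _ _ _ _ _ C) => h h1.
rewrite -[sumO (dcoef c) t p](wsumE cd) /= [h *: (1 : R)]mulr1 [h + t]addrC.
have box' : `|t + h| + `|p| + 2 <= box t p.
  by rewrite /box; have := ler_normD t h; lra.
apply: HC => [k|k||k].
- by have [] := ax_bound n_gt0 k box'.
- by have [] := ax_bound n_gt0 k (box_ge t p).
- exact: cvgP cd.
- by have [] := ax_quadratic_t n_gt0 k (lexx (box t p)) h1.
Qed.

(** First equation of the monogenicity system for the sums: [sumO (dcoef c)] is the [t]-derivative
    of [sumO c]. *)
Lemma sumE_derive_p c t p : entire c ->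
  is_derive p (1 : R) (sumE c t) (- (sumO (dcoef c) t p / 2)).
Proof.
move=> ec; have [C HC] := wsum_quadratic ec (box_ge0 t p).
have cd := wsum_deriv (cvgP _ (@sumO_cvg _ t p (entire_deriv ec))).
have {}cd : series (fun k => axV n t p k * c k) @ \oo -->
    - (sumO (dcoef c) t p / 2).
  have := series_cvgZ (- (1 / 2)) cd.
  rewrite (_ : - (1/2) * wsum _ _ = - (sumO (dcoef c) t p / 2)); last first.
    by rewrite /sumO; field.
  under eq_fun => k.
    rewrite (_ : _ * _ = axV n t p k * c k).
    over.
    by rewrite (proj1 (ax_deriv_p n_gt0 t p k)); field.
  by [].
apply: (@is_derive_quadratic _ _ _ _ _ _ C) => h h1.
rewrite -(wsumE cd) /= [h *: (1 : R)]mulr1 [h + p]addrC.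
have box' : `|t| + `|p + h| + 2 <= box t p.
  by rewrite /box; have := ler_normD p h; lra.
apply: HC => [k|k||k].
- by have [] := ax_bound n_gt0 k box'.
- by have [] := ax_bound n_gt0 k (box_ge t p).
- exact: cvgP cd.
- by have [] := ax_quadratic_p n_gt0 k (lexx (box t p)) h1.
Qed.

Lemma sumO_derive_p c t p : entire c ->
  is_derive p (1 : R) (sumO c t) (sumW c t p).
Proof.
move=> ec; have [C HC] := wsum_quadratic ec (box_ge0 t p).
apply: (@is_derive_quadratic _ _ _ _ _ _ C) => h h1.
rewrite [h *: (1 : R)]mulr1 [h + p]addrC.
have box' : `|t| + `|p + h| + 2 <= box t p.
  by rewrite /box; have := ler_normD p h; lra.
apply: HC => [k|k||k].
- by have [] := ax_bound n_gt0 k box'.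
- by have [] := ax_bound n_gt0 k (box_ge t p).
- exact: cvgP (@sumW_cvg c t p ec).
- by have [] := ax_quadratic_p n_gt0 k (lexx (box t p)) h1.
Qed.

(** Second equation of the monogenicity system for the sums, with [sumW c] the [p]-derivative of
    [sumO c]. *)
Lemma sumE_deriv c t p : entire c ->
  sumE (dcoef c) t p = n%:R * sumO c t p + 2 * p * sumW c t p.
Proof.
move=> ec.
rewrite -[LHS](wsumE (wsum_deriv (cvgP _ (@sumE_cvg _ t p (entire_deriv ec))))).
apply: wsumE; have := series_cvgD (series_cvgZ n%:R (@sumO_cvg c t p ec))
  (series_cvgZ (2 * p) (@sumW_cvg c t p ec)).
under eq_fun => k do rewrite !mulrA -mulrDl -(proj2 (ax_deriv_p n_gt0 t p k)).
by [].
Qed.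

Lemma wsum_continuous (T : topologicalType) (f : R -> R -> nat -> R) c
    (u v : T -> R) : entire c ->
  (forall t p K k, `|t| + `|p| + 2 <= K -> `|f t p k| <= K ^+ k) ->
  (forall t p t' p' K k, `|t| + `|p| + 2 <= K -> `|t'| + `|p'| + 2 <= K ->
     `|f t p k - f t' p' k| <= (`|t - t'| + `|p - p'|) * K ^+ k) ->
  continuous u -> continuous v -> continuous (fun x => wsum (f (u x) (v x)) c).
Proof.
move=> ec fb fl cu cv x.
(* The growth bounds require 2; the other 2 allows [u] and [v] to move by 1 each near [x]. *)
pose K := `|u x| + `|v x| + 4.
have K0 : 0 <= K by rewrite !addr_ge0.
have [C C0 HC] := wsum_lipschitz ec K0.
apply/cvgrPdist_le => e e0.
pose r := e / (2 * (C + 1)).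
have r0 : 0 < r by rewrite divr_gt0 // mulr_gt0 //; lra.
have Nu := (cvgrPdist_le _ _).1 (cu x); have Nv := (cvgrPdist_le _ _).1 (cv x).
near=> y.
have ur : `|u x - u y| <= r by near: y; exact: Nu.
have vr : `|v x - v y| <= r by near: y; exact: Nv.
have u1 : `|u x - u y| <= 1 by near: y; exact: Nu.
have v1 : `|v x - v y| <= 1 by near: y; exact: Nv.
have Kx : `|u x| + `|v x| + 2 <= K by rewrite /K; lra.
have Ky : `|u y| + `|v y| + 2 <= K.
  have := lerB_dist (u y) (u x); have := lerB_dist (v y) (v x).
  by rewrite /K [`|u y - _|]distrC [`|v y - _|]distrC; lra.
apply: le_trans (HC _ _ (`|u x - u y| + `|v x - v y|) _ _ _) _ => [k|k|k|].
- exact: fb.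
- exact: fb.
- exact: fl.
- apply: (@le_trans _ _ ((2 * r) * (C + 1))); last first.
    by rewrite (_ : 2 * r * (C + 1) = e) // /r; field; lra.
  by rewrite ler_pM ?addr_ge0 //; lra.
Unshelve. all: by end_near. Qed.

Lemma sumE_continuous (T : topologicalType) c (u v : T -> R) : entire c ->
  continuous u -> continuous v -> continuous (fun x => sumE c (u x) (v x)).
Proof.
move=> ec; apply: wsum_continuous => // [t p K k h|t p t' p' K k h h'].
  by have [] := ax_bound n_gt0 k h.
by have [] := ax_lipschitz n_gt0 k h h'.
Qed.

Lemma sumO_continuous (T : topologicalType) c (u v : T -> R) : entire c ->
  continuous u -> continuous v -> continuous (fun x => sumO c (u x) (v x)).
Proof.
move=> ec; apply: wsum_continuous => // [t p K k h|t p t' p' K k h h'].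
  by have [] := ax_bound n_gt0 k h.
by have [] := ax_lipschitz n_gt0 k h h'.
Qed.

Lemma sumW_continuous (T : topologicalType) c (u v : T -> R) : entire c ->
  continuous u -> continuous v -> continuous (fun x => sumW c (u x) (v x)).
Proof.
move=> ec; apply: wsum_continuous => // [t p K k h|t p t' p' K k h h'].
  by have [] := ax_dbound n_gt0 k h.
by have [] := ax_dlipschitz n_gt0 k h h'.
Qed.

End AxialSeries.

(** * One-variable power series: the restriction to the real line *)

Section PowerSeries.
Context {R : realType}.
Implicit Types (c : nat -> R) (t : R) (k m : nat).

Definition pser c t : R := wsum (fun k => t ^+ k) c.

Lemma pserE n c t : pser c t = sumE n c t 0.
Proof. by rewrite /pser /sumE; congr wsum; apply/funext => k; rewrite axE_real. Qed.

Lemma pser_cvg c t : entire c -> series (fun k => t ^+ k * c k) @ \oo --> pser c t.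
Proof.
move=> ec; rewrite (pserE 1).
under eq_fun do rewrite -(axE_real 1); exact: sumE_cvg.
Qed.

Lemma pser_derive c t : entire c -> is_derive t (1 : R) (pser c) (pser (dcoef c) t).
Proof.
move=> ec; rewrite (pserE 1) (_ : pser c = fun s => sumE 1 c s 0).
  exact: sumE_derive_t.
by apply/funext => s; rewrite -pserE.
Qed.

Lemma pser_continuous c : entire c -> continuous (pser c).
Proof.
move=> ec; rewrite (_ : pser c = fun s => sumE 1 c s 0); last first.
  by apply/funext => s; rewrite -pserE.
apply: sumE_continuous => // s; [exact: cvg_id|exact: cvg_cst].
Qed.

Lemma pserS c t : entire c -> pser c t = c 0 + t * pser (fun k => c k.+1) t.
Proof.
move=> ec; apply: wsumE; rewrite -cvg_shiftS.
rewrite (_ : [sequence _]_m =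
  (fun m => c 0 + series (fun k => t * (t ^+ k * c k.+1)) m)).
  apply: cvgD; first exact: cvg_cst.
  exact/series_cvgZ/pser_cvg/entire_shift.
apply/funext => m; rewrite /series /= big_nat_recl //= expr0 mul1r.
by congr (_ + _); apply: eq_bigr => k _; rewrite exprS mulrA.
Qed.

Lemma pser0 c : entire c -> pser c 0 = c 0.
Proof. by move=> ec; rewrite pserS // mul0r addr0. Qed.

Lemma pser_eq0 c : entire c -> (forall t, pser c t = 0) -> forall k, c k = 0.
Proof.
move=> ec pc0 k; elim: k c ec pc0 => [|k IH] c ec pc0; first by rewrite -pser0.
have : dcoef c k = 0.
  apply: IH => [|t]; first exact: entire_deriv.
  have [_ <-] := pser_derive t ec.
  by rewrite (_ : pser c = cst 0) ?derive_cst //; apply/funext.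
by move/eqP; rewrite mulf_eq0 pnatr_eq0 => /eqP.
Qed.

(** The factor [t ^+ m] splits off, and the remaining series is continuous at 0 with value [c m]. In
    the uniqueness proof this reads off leading coefficients along a sequence. *)
Lemma pser_lead c m (r : nat -> R) : entire c -> (forall i, (i < m)%N -> c i = 0) ->
  (forall k, r k != 0) -> r @ \oo --> 0 ->
  (fun k => pser c (r k) / r k ^+ m) @ \oo --> c m.
Proof.
move=> ec c0 r0 rl.
have {c0} H : forall t, pser c t = t ^+ m * pser (fun k => c (k + m)%N) t.
  move=> t; elim: m c ec c0 => [|m IH] c ec c0.
    by rewrite mul1r; congr pser; apply/funext => k; rewrite addn0.
  rewrite pserS // c0 // add0r IH => [||i im]; first 1 last.
  - exact: entire_shift.
  - exact: c0.
  by rewrite exprS mulrA; congr (_ * pser _ _); apply/funext => k; rewrite addnS.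
have ecm := entire_shiftn m ec.
under eq_fun do rewrite H mulrC mulKf ?expf_neq0 //.
rewrite -[X in c X]add0n -(pser0 ecm).
by apply: continuous_cvg => //; exact: pser_continuous.
Qed.

End PowerSeries.

Local Close Scope classical_set_scope.

(** * Coordinates in the Clifford algebra and the vector part of a point *)

Section CliffordCoordinates.
Context {R : realType} {n : nat}.
Local Notation Cl := (clifford R n).
Implicit Types (a b : Cl) (A : {set 'I_n}).

Lemma clDE a b A : (a + b) A = a A + b A. Proof. by rewrite ffunE. Qed.

Lemma clNE a A : (- a) A = - a A. Proof. by rewrite ffunE. Qed.

Lemma cl0E A : (0 : Cl) A = 0. Proof. by rewrite ffunE. Qed.

Lemma cl_coord_sum (I : Type) (s : seq I) (P : pred I) (f : I -> Cl) A :
  (\sum_(i <- s | P i) f i) A = \sum_(i <- s | P i) f i A.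
Proof. by apply: (big_morph (fun a : Cl => a A)) => [a b|]; rewrite ?clDE ?cl0E. Qed.

Lemma cl_gen_mulE (l : 'I_n) a A : (cl_gen l * a) A =
  clsign [set l] (symdiff [set l] A) * a (symdiff [set l] A).
Proof.
rewrite clME (bigD1 [set l]) //= big1 => [|B Bl].
  by rewrite addr0 ffunE eqxx mulr1.
by rewrite ffunE (negbTE Bl) mulr0 mul0r.
Qed.

Lemma cl_conjK : involutive (cl_conj : Cl -> Cl).
Proof. by move=> a; apply/ffunP => A; rewrite !ffunE mulrA clsign_sqr mul1r. Qed.

Lemma cl_norm_sqr a : cl_norm a ^+ 2 = \sum_A a A ^+ 2.
Proof. by rewrite sqr_sqrtr // sumr_ge0 // => A _; exact: sqr_ge0. Qed.

Lemma cl_conj_mul0 a : (cl_conj a * a) finset.set0 = cl_norm a ^+ 2.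
Proof.
rewrite cl_norm_sqr clME; apply: eq_bigr => A _.
by rewrite symdiffs0 ffunE mulrA clsign_sqr mul1r expr2.
Qed.

End CliffordCoordinates.

Section VectorPart.
Context {R : realType} {n : nat}.
Local Notation Cl := (clifford R n).
Local Notation Pt := 'rV[R]_n.+1.
Implicit Types (x : Pt).

Definition vec_sqr x : R := \sum_(l < n) x 0 (lift ord0 l) ^+ 2.

Lemma vec_sqr_ge0 x : 0 <= vec_sqr x.
Proof. by rewrite sumr_ge0 // => l _; exact: sqr_ge0. Qed.

Lemma vec_part_sqr x : vec_part x * vec_part x = (- vec_sqr x)%:A.
Proof.
pose y l := x 0 (lift ord0 l).
have e : vec_part x * vec_part x =
    \sum_(l < n) \sum_(m < n) (y l * y m) *: (cl_gen l * cl_gen m : Cl).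
  rewrite /vec_part mulr_suml; apply: eq_bigr => l _.
  rewrite mulr_sumr; apply: eq_bigr => m _.
  by rewrite -scalerAl -scalerAr scalerA.
(* Doubling symmetrises the double sum: adding its transpose cancels the off-diagonal terms by
   anticommutation. *)
apply: (@scalerI _ _ (2 : R)); first by rewrite pnatr_eq0.
rewrite [LHS]scaler_nat mulr2n {1}e e [X in _ + X]exchange_big -big_split /=.
rewrite scalerA mulrN -mulNr mulr_sumr scaler_suml; apply: eq_bigr => l _.
rewrite -big_split /= (bigD1 l) //= big1 => [|m ml]; last first.
  by rewrite [y m * _]mulrC -scalerDr cl_gen_anticomm ?scaler0 // eq_sym.
rewrite addr0 -[cl_gen l * _]expr2 cl_gen_sqr -scalerDl scalerN -scaleNr; congr (_ *: _).
by rewrite /y; ring.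
Qed.

Lemma cl_conj_vec_part x : cl_conj (vec_part x) = - vec_part x.
Proof.
rewrite /vec_part linear_sum -sumrN; apply: eq_bigr => l _.
by rewrite linearZ /= cl_conj_gen scalerN.
Qed.

Lemma cl_norm_vec_part x : cl_norm (vec_part x) = Num.sqrt (vec_sqr x).
Proof.
rewrite -[LHS]ger0_norm ?sqrtr_ge0 // -sqrtr_sqr -cl_conj_mul0.
rewrite cl_conj_vec_part mulNr vec_part_sqr scaleNr opprK clZE ffunE eqxx mulr1 //.
Qed.

Lemma vec_part_mulE x (a : Cl) A :
  (vec_part x * a) A = \sum_(l < n) x 0 (lift ord0 l) * (cl_gen l * a) A.
Proof.
rewrite /vec_part mulr_suml cl_coord_sum; apply: eq_bigr => l _.
by rewrite -scalerAl clZE.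
Qed.

Lemma real_pointE (t : R) (i : 'I_n.+1) : real_point n t 0 i = t * (i == ord0)%:R.
Proof. by rewrite /real_point !mxE eqxx. Qed.

Lemma vec_part_real (t : R) : vec_part (real_point n t) = 0.
Proof.
rewrite /vec_part big1 // => l _.
by rewrite real_pointE eq_sym (negbTE (neq_lift _ _)) mulr0 scale0r.
Qed.

Lemma vec_sqr_real (t : R) : vec_sqr (real_point n t) = 0.
Proof.
rewrite /vec_sqr big1 // => l _.
by rewrite real_pointE eq_sym (negbTE (neq_lift _ _)) mulr0 expr0n.
Qed.

Lemma real_point0 (t : R) : real_point n t 0 0 = t.
Proof. by rewrite real_pointE eqxx mulr1. Qed.

End VectorPart.

(** * From the binomial-type definition of [appell] to its axial components *)

Section Appell.
Context {R : realType} {n : nat}.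
Hypothesis n_gt0 : (0 < n)%N.
Local Notation Cl := (clifford R n).
Implicit Types (k s : nat) (u v : Cl).

Let lam : R := (n%:R - 1) / 2.

Lemma risingSr (a : R) s : rising a s.+1 = rising a s * (a + s%:R).
Proof. by rewrite /rising big_ord_recr. Qed.

Lemma risingSl (a : R) s : rising a s.+1 = a * rising (a + 1) s.
Proof.
rewrite /rising big_ord_recl addr0; congr (_ * _); apply: eq_bigr => i _ /=.
by rewrite /bump /= add1n -natr1 addrAC addrA.
Qed.

Lemma rising_gt0 (a : R) s : 0 < a -> 0 < rising a s.
Proof. by move=> a0; apply: prodr_gt0 => i _; rewrite ltr_wpDr. Qed.

Lemma rising_shift (a : R) s : a * rising (a + 1) s = rising a s * (a + s%:R).
Proof. by rewrite -risingSl risingSr. Qed.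

(** This compares the coefficients of [u ^+ (k.+1 - s) * v ^+ s] in [appell_form_rec]. The index
    [k.+1 - s] comes from exchanging [u] and [v]; [rising_shift] brings the Pochhammer products of
    that coefficient back to those of index [s]. *)
Lemma appell_coef_rec k s : (s <= k)%N ->
  k.+1%:R * appell_coef R n k s =
  (k.+1%:R + lam) * appell_coef R n k.+1 s
  - lam * appell_coef R n k.+1 (k.+1 - s).
Proof.
move=> sk; have sk1 : (s <= k.+1)%N by exact: leqW.
have l1 : (n%:R + 1) / 2 = lam + 1 by rewrite /lam; field.
have nk : n%:R + k%:R != 0 :> R by rewrite -natrD pnatr_eq0 addn_eq0 negb_and -lt0n n_gt0.
have rn : rising (n%:R : R) k != 0 by rewrite gt_eqF // rising_gt0 // ltr0n.
rewrite /appell_coef subKn // bin_sub // l1 -/lam !risingSr subSn // !risingSr.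
rewrite natrB // .
have bin : k.+1%:R * 'C(k, s)%:R = (k.+1%:R - s%:R) * 'C(k.+1, s)%:R :> R.
  by rewrite -natrB // -!natrM -mul_bin_down.
set Z1 := rising (lam + 1) (k - s); set Z2 := rising lam s.
have X : lam * (rising (lam + 1) s * (rising lam (k - s) * (lam + (k%:R - s%:R))))
   = lam * ((lam + s%:R) * (Z1 * Z2)).
  rewrite -natrB // mulrA [lam * rising _ s]rising_shift.
  by rewrite -[rising _ _ * (_ + (k - s)%:R)]rising_shift -/Z1 -/Z2; ring.
have -> : lam * ('C(k.+1, s)%:R
    * (rising (lam + 1) s * (rising lam (k - s) * (lam + (k%:R - s%:R))))
    / (rising n%:R k * (n%:R + k%:R)))
  = 'C(k.+1, s)%:R * (lam * ((lam + s%:R) * (Z1 * Z2))) / (rising n%:R k * (n%:R + k%:R)).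
  by rewrite -X; ring.
rewrite !mulrA bin -natr1 /lam.
by field; rewrite rn nk.
Qed.

(** The pure power [v ^+ k.+1] cannot occur in a multiple of [u], so its coefficient in
    [appell_form_rec] must cancel. *)
Lemma appell_coef_rec_last k :
  (k.+1%:R + lam) * appell_coef R n k.+1 k.+1 - lam * appell_coef R n k.+1 0 = 0.
Proof.
have l1 : (n%:R + 1) / 2 = lam + 1 by rewrite /lam; field.
rewrite /appell_coef l1 -/lam subnn subn0 bin0 binn.
have r0 (a : R) : rising a 0 = 1 by rewrite /rising big_ord0.
rewrite !r0 !mulr1 !mul1r !mulrA rising_shift -mulrBl.
by rewrite [(_ + lam) * _]mulrC [_ + lam]addrC subrr mul0r.
Qed.

(** [appell] with the point and its conjugate replaced by two variables: multiplication by [u]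
    produces also the polynomial with [u] and [v] exchanged. *)
Definition appell_form k u v : Cl :=
  \sum_(s < k.+1) appell_coef R n k s *: (u ^+ (k - s) * v ^+ s).

Lemma appell_form_rec k u v : u * v = v * u ->
  k.+1%:R *: (u * appell_form k u v) =
  (k.+1%:R + lam) *: appell_form k.+1 u v - lam *: appell_form k.+1 v u.
Proof.
move=> uv; have -> : appell_form k.+1 v u =
    \sum_(s < k.+2) appell_coef R n k.+1 (k.+1 - s) *: (u ^+ (k.+1 - s) * v ^+ s).
  rewrite /appell_form (reindex_inj rev_ord_inj) /=; apply: eq_bigr => s _.
  rewrite subSS subKn; last by rewrite -ltnS.
  by congr (_ *: _); apply/commrX/commr_sym/commrX.
rewrite /appell_form !scaler_sumr mulr_sumr scaler_sumr -sumrB.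
rewrite [RHS]big_ord_recr /= subnn !scalerA -scalerBl appell_coef_rec_last scale0r addr0.
apply: eq_bigr => s _; have sk : (s <= k)%N by rewrite -ltnS.
rewrite !scalerA -scalerBl -appell_coef_rec // -scalerAr scalerA.
by rewrite subSn // exprS -mulrA.
Qed.

Lemma axial_mul (x : 'rV[R]_n.+1) (b := vec_part x) (r1 s1 r2 s2 : R) :
  (r1%:A + s1 *: b) * (r2%:A + s2 *: b) =
  (r1 * r2 - vec_sqr x * (s1 * s2))%:A + (r1 * s2 + s1 * r2) *: b.
Proof.
rewrite -[LHS]addr0 mulrDl !mulrDr -![in LHS]scalerAl -![in LHS]scalerAr !mul1r mulr1.
by rewrite vec_part_sqr; apply/ffunP => A; rewrite !(clDE, clZE, cl0E); ring.
Qed.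

(** Sum and difference decouple the system: [p + q = 2 e], while [p - q] is scaled by
    [r / (r + 2 m)]. For [r = k + 1] and [m = (n - 1) / 2] this ratio is [odd_weight n k]. *)
Lemma axial_system (r m : R) (p q e f g : Cl) : r != 0 -> r + 2 * m != 0 ->
  r *: (e + f) = (r + m) *: p - m *: q -> r *: (e - f) = (r + m) *: q - m *: p ->
  (r + 2 * m) *: g = r *: f -> p = e + g /\ q = e - g.
Proof.
move=> r0 m0 /ffunP Hp /ffunP Hq /ffunP Hg.
have solve A : p A = e A + g A /\ q A = e A - g A.
  have := Hp A; have := Hq A; have := Hg A; rewrite !(clDE, clNE, clZE) => {}Hg {}Hp {}Hq.
  have sum : p A + q A = 2 * e A by apply: (mulfI r0); lra.
  have diff : p A - q A = 2 * g A by apply: (mulfI m0); lra.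
  by split; lra.
by split; apply/ffunP => A; have [] := solve A; rewrite !(clDE, clNE).
Qed.

(** The polynomial and the one with the point and its conjugate exchanged go through the induction
    together: the two instances of [appell_form_rec] form a linear system for the next pair. *)
Lemma appell_formE k (x : 'rV[R]_n.+1) (b := vec_part x) (t := x 0 0)
    (e := axE n t (vec_sqr x)) (o := axO n t (vec_sqr x)) :
  appell_form k (t%:A + b) (t%:A - b) = (e k)%:A + o k *: b /\
  appell_form k (t%:A - b) (t%:A + b) = (e k)%:A - o k *: b.
Proof.
have bE : b = 1 *: b by rewrite scale1r.
have comm : (t%:A + b) * (t%:A - b) = (t%:A - b) * (t%:A + b).
  rewrite bE -scaleNr !axial_mul; congr (_ *: _ + _ *: _); ring.
elim: k => [|k [IHP IHN]].
  have c0 : appell_coef R n 0 0 = 1.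
    by rewrite /appell_coef /rising !big_ord0 bin0 divr1 !mulr1.
  by rewrite /appell_form !big_ord1 c0 /e /o axO0 !scale0r addr0 subr0 !mul1r.
have := appell_form_rec k comm; have := appell_form_rec k (esym comm).
rewrite IHP IHN {IHP IHN}.
set P := appell_form k.+1 _ _; set N := appell_form k.+1 _ _.
have oS : (k.+1%:R + 2 * lam) * o k.+1 = k.+1%:R * (t * o k + e k).
  rewrite -[in RHS](@odd_weightK _ _ n_gt0) -mulrA -axOS -/(o _) natrD -natr1 /lam.
  by field.
have -> : (t%:A + b) * ((e k)%:A + o k *: b) = (e k.+1)%:A + (t * o k + e k) *: b.
  by rewrite {1}bE axial_mul; congr (_ *: _ + _ *: _); rewrite /e ?axES /o; ring.
have -> : (t%:A - b) * ((e k)%:A - o k *: b) = (e k.+1)%:A - (t * o k + e k) *: b.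
  rewrite {1}bE -!scaleNr axial_mul; congr (_ *: _ + _ *: _); rewrite /e ?axES /o; ring.
move=> eN eP.
apply: axial_system eP eN _; first by rewrite pnatr_eq0.
  rewrite (_ : _ + _ = (k + n)%:R).
    by rewrite pnatr_eq0 addn_eq0 negb_and -!lt0n n_gt0 orbT.
  by rewrite natrD -natr1 /lam; field.
by rewrite !scalerA oS.
Qed.

Lemma appellE k (x : 'rV[R]_n.+1) : appell k x =
  (axE n (x 0 0) (vec_sqr x) k)%:A + axO n (x 0 0) (vec_sqr x) k *: vec_part x.
Proof.
rewrite -(proj1 (appell_formE k x)) /appell cl_conj_paravector.
by apply: eq_bigr.
Qed.

Lemma appell_real k (t : R) : appell k (real_point n t) = (t ^+ k)%:A.
Proof.
by rewrite appellE vec_part_real scaler0 addr0 vec_sqr_real real_point0 axE_real.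
Qed.

End Appell.

(** * Differential calculus for Clifford-valued axial functions *)

Section CliffordDerivative.
Context {R : realType} {n : nat}.
Local Notation Cl := (clifford R n).
Implicit Types (f g : R -> Cl) (d e z : Cl) (t : R).

Definition cl_derive f t d := forall A, is_derive t (1 : R) (fun s => f s A) (d A).

Lemma is_derive_ext (f g : R -> R) (t d : R) :
  f =1 g -> is_derive t (1 : R) f d -> is_derive t (1 : R) g d.
Proof. by move/funext->. Qed.

Lemma cl_derive_cst z t : cl_derive (fun=> z) t 0.
Proof. by move=> A; rewrite cl0E; exact: is_derive_cst. Qed.

Lemma cl_deriveD f g t d e : cl_derive f t d -> cl_derive g t e ->
  cl_derive (fun s => f s + g s) t (d + e).
Proof.
move=> fd ge A; rewrite clDE; apply: is_derive_ext (is_deriveD (fd A) (ge A)) => s.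
by rewrite clDE.
Qed.

Lemma cl_deriveZ (r : R -> R) f t (dr : R) d : is_derive t (1 : R) r dr ->
  cl_derive f t d -> cl_derive (fun s => r s *: f s) t (r t *: d + dr *: f t).
Proof.
move=> rd fd A; rewrite clDE !clZE [dr * _]mulrC.
by apply: is_derive_ext (is_deriveM rd (fd A)) => s; rewrite clZE.
Qed.

Lemma cl_derive_sum (I : Type) (s : seq I) (f : I -> R -> Cl) (d : I -> Cl) t :
  (forall i, cl_derive (f i) t (d i)) ->
  cl_derive (fun r => \sum_(i <- s) f i r) t (\sum_(i <- s) d i).
Proof.
move=> fd; elim: s => [|i s IH].
  by under eq_fun do rewrite big_nil; rewrite big_nil; exact: cl_derive_cst.
by under eq_fun do rewrite big_cons; rewrite big_cons; exact: cl_deriveD.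
Qed.

Lemma cl_derive_gen (l : 'I_n) f t d : cl_derive f t d ->
  cl_derive (fun s => cl_gen l * f s) t (cl_gen l * d).
Proof.
move=> fd A; rewrite cl_gen_mulE.
by apply: is_derive_ext (is_deriveZ _ (fd _)) => s; rewrite cl_gen_mulE.
Qed.

Lemma cl_derive_vec (x : 'rV[R]_n.+1) f t d : cl_derive f t d ->
  cl_derive (fun s => vec_part x * f s) t (vec_part x * d).
Proof.
move=> fd; rewrite /vec_part mulr_suml.
under eq_fun do rewrite mulr_suml.
apply: cl_derive_sum => l; rewrite -scalerAl.
under eq_fun do rewrite -scalerAl.
have -> : x 0 (lift ord0 l) *: (cl_gen l * d) =
    x 0 (lift ord0 l) *: (cl_gen l * d) + 0 *: (cl_gen l * f t).
  by rewrite scale0r addr0.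
exact: cl_deriveZ (is_derive_cst (x 0 (lift ord0 l)) t 1) (cl_derive_gen l fd).
Qed.

Lemma is_derive_comp (f g : R -> R) (t df dg : R) : is_derive t (1 : R) f df ->
  is_derive (f t) (1 : R) g dg -> is_derive t (1 : R) (fun s => g (f s)) (df * dg).
Proof.
move=> [fd fE] [gd gE]; have [/derivable1_diffP fd' /derivable1_diffP gd'] := (fd, gd).
split; first by apply/derivable1_diffP; exact: differentiable_comp.
by rewrite -derive1E (derive1_comp fd gd) !derive1E fE gE mulrC.
Qed.

Lemma cl_derive_comp (r : R -> R) f t (dr : R) d : is_derive t (1 : R) r dr ->
  cl_derive f (r t) d -> cl_derive (fun s => f (r s)) t (dr *: d).
Proof. by move=> rd fd A; rewrite clZE; exact: is_derive_comp rd (fd A). Qed.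

End CliffordDerivative.

Section AxialFunctions.
Context {R : realType} {n : nat}.
Local Notation Cl := (clifford R n).
Local Notation Pt := 'rV[R]_n.+1.
Implicit Types (x : Pt) (l : 'I_n) (h t p : R) (a b : R -> R -> Cl) (da db : Cl).

(** The components depend on the squared modulus rather than on the modulus, so parity is built in
    and nothing is singular on the real line. *)
Definition axial_fun a b x : Cl :=
  a (x 0 0) (vec_sqr x) + vec_part x * b (x 0 0) (vec_sqr x).

Lemma line_ord0 x h : (h *: unit_vec R ord0 + x) 0 0 = h + x 0 0.
Proof. by rewrite !mxE !eqxx mulr1. Qed.

Lemma line_vec0 x h l : (h *: unit_vec R ord0 + x) 0 (lift ord0 l) = x 0 (lift ord0 l).
Proof. by rewrite !mxE eq_sym (negbTE (neq_lift _ _)) andbF mulr0 add0r. Qed.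

Lemma vec_part_line0 x h : vec_part (h *: unit_vec R ord0 + x) = vec_part x.
Proof. by apply: eq_bigr => l _; rewrite line_vec0. Qed.

Lemma vec_sqr_line0 x h : vec_sqr (h *: unit_vec R ord0 + x) = vec_sqr x.
Proof. by apply: eq_bigr => l _; rewrite line_vec0. Qed.

Lemma line_lift0 x h l : (h *: unit_vec R (lift ord0 l) + x) 0 0 = x 0 0.
Proof. by rewrite !mxE (negbTE (neq_lift _ _)) andbF mulr0 add0r. Qed.

Lemma line_lift x h l m : (h *: unit_vec R (lift ord0 l) + x) 0 (lift ord0 m) =
  h * (m == l)%:R + x 0 (lift ord0 m).
Proof. by rewrite !mxE eqxx (inj_eq lift_inj). Qed.

Lemma vec_part_line x h l :
  vec_part (h *: unit_vec R (lift ord0 l) + x) = vec_part x + h *: cl_gen l.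
Proof.
rewrite /vec_part (bigD1 l) //= [in RHS](bigD1 l) //= line_lift eqxx mulr1 scalerDl.
rewrite addrC -[in RHS]addrA [RHS]addrC addrA; congr (_ + _ + _).
by apply: eq_bigr => m ml; rewrite line_lift (negbTE ml) mulr0 add0r.
Qed.

Lemma vec_sqr_line x h l : vec_sqr (h *: unit_vec R (lift ord0 l) + x) =
  vec_sqr x + (h * (2 * x 0 (lift ord0 l)) + h ^+ 2).
Proof.
rewrite /vec_sqr (bigD1 l) //= [in RHS](bigD1 l) //= line_lift eqxx mulr1.
rewrite (eq_bigr (fun m => x 0 (lift ord0 m) ^+ 2)); first by ring.
by move=> m ml; rewrite line_lift (negbTE ml) mulr0 add0r.
Qed.

Lemma axial_derive_lift a b x l da db (t := x 0 0) (p := vec_sqr x) A :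
  cl_derive (a t) p da -> cl_derive (b t) p db ->
  is_derive x (unit_vec R (lift ord0 l)) (coord_fun (axial_fun a b) A)
    (((2 * x 0 (lift ord0 l)) *: (da + vec_part x * db) + cl_gen l * b t p) A).
Proof.
move=> ha hb; apply/is_derive_line; rewrite /coord_fun.
pose y := x 0 (lift ord0 l).
(* The squared modulus along the line through [x] in direction [e_l]; its derivative [2 * y] at 0
   enters the chain rule. *)
pose q h := p + (h * (2 * y) + h ^+ 2).
have q0 : q 0 = p by rewrite /q mul0r expr0n addr0 addr0.
have dq : is_derive (0 : R) (1 : R) q (2 * y).
  apply: (@is_derive_quadratic _ _ _ _ _ _ 1) => h _.
  rewrite q0 [h *: _]mulr1 addr0 (_ : _ - _ = h ^+ 2); last by rewrite /q; ring.
  by rewrite mulr1 normrX real_normK ?num_real.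
have ha' : cl_derive (fun h => a t (q h)) 0 ((2 * y) *: da).
  by apply: cl_derive_comp dq _; rewrite q0.
have hb' : cl_derive (fun h => b t (q h)) 0 ((2 * y) *: db).
  by apply: cl_derive_comp dq _; rewrite q0.
have := cl_deriveD (cl_deriveD ha' (cl_derive_vec x hb'))
  (cl_deriveZ (is_derive_id _ _) (cl_derive_gen l hb')) => /(_ A).
rewrite scale0r add0r scale1r q0 -scalerAr -scalerDr => H.
apply: is_derive_ext H => h.
rewrite /axial_fun line_lift0 vec_sqr_line vec_part_line -/(q h) -/t.
by rewrite mulrDl -scalerAl addrA.
Qed.

Lemma axial_derive0 a b x da db (t := x 0 0) (p := vec_sqr x) A :
  cl_derive (a^~ p) t da -> cl_derive (b^~ p) t db ->
  is_derive x (unit_vec R ord0) (coord_fun (axial_fun a b) A) ((da + vec_part x * db) A).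
Proof.
move=> ha hb; apply/is_derive_line; rewrite /coord_fun.
have ds : is_derive (0 : R) (1 : R) (fun h => h + t) 1.
  apply: (@is_derive_quadratic _ _ _ _ _ _ 0) => h _.
  by rewrite [h *: _]mulr1 addr0 add0r mulr1 addrK subrr normr0 mulr0.
have ha' : cl_derive (fun h => a (h + t) p) 0 da.
  by rewrite -[da]scale1r; apply: (cl_derive_comp (f := a^~ p) ds); rewrite add0r.
have hb' : cl_derive (fun h => b (h + t) p) 0 db.
  by rewrite -[db]scale1r; apply: (cl_derive_comp (f := b^~ p) ds); rewrite add0r.
have := cl_deriveD ha' (cl_derive_vec x hb') => /(_ A) H.
apply: is_derive_ext H => h.
by rewrite /axial_fun line_ord0 vec_part_line0 vec_sqr_line0.
Qed.

(** The coordinates times the generators reassemble to [vec_part x], whose square is [- p], and the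
    [n] squares [e_l^2 = -1] produce the term with [n]. *)
Lemma vec_dirac_axial a b x da db (t := x 0 0) (p := vec_sqr x) :
  cl_derive (a t) p da -> cl_derive (b t) p db ->
  vec_dirac (axial_fun a b) x =
    2 *: (vec_part x * da) - n%:R *: b t p - (2 * p) *: db.
Proof.
move=> ha hb; rewrite /vec_dirac.
have E l : partial (lift ord0 l) (axial_fun a b) x =
    (2 * x 0 (lift ord0 l)) *: (da + vec_part x * db) + cl_gen l * b t p.
  apply/ffunP => A; rewrite ffunE.
  by have [_ ->] := axial_derive_lift l A ha hb.
under eq_bigr => l _.
  rewrite E mulrDr -scalerAr mulrA -[cl_gen l * cl_gen l]expr2 cl_gen_sqr mulN1r.
  over.
rewrite big_split /=.
have -> : \sum_(l < n) - b t p = - (n%:R *: b t p).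
  by rewrite sumr_const card_ord scaler_nat mulNrn.
have -> : \sum_(l < n) (2 * x 0 (lift ord0 l)) *: (cl_gen l * (da + vec_part x * db)) =
    2 *: (vec_part x * (da + vec_part x * db)).
  move: (da + _) => z; rewrite /vec_part mulr_suml scaler_sumr.
  by apply: eq_bigr => l _; rewrite -scalerAl scalerA.
rewrite mulrDr mulrA vec_part_sqr -scalerAl mul1r scalerDr scalerA mulrN scaleNr.
by rewrite addrAC.
Qed.

End AxialFunctions.

Local Open Scope classical_set_scope.
Local Open Scope ring_scope.

(** * Clifford-valued series and entire coefficients *)

Section CliffordSums.
Context {R : realType} {n : nat}.
Local Notation Cl := (clifford R n).
Implicit Types (u v alpha : nat -> Cl) (s z : Cl).

Lemma cl_has_sum_unique u s s' : cl_has_sum u s -> cl_has_sum u s' -> s = s'.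
Proof. by move=> us us'; apply/ffunP => A; apply: cvg_unique (us A) (us' A). Qed.

Lemma cl_has_sumD u v s s' : cl_has_sum u s -> cl_has_sum v s' ->
  cl_has_sum (fun k => u k + v k) (s + s').
Proof.
move=> us vs A; rewrite clDE; under eq_fun do rewrite clDE.
exact: series_cvgD (us A) (vs A).
Qed.

Lemma cl_has_sumZ (r : R) u s : cl_has_sum u s -> cl_has_sum (fun k => r *: u k) (r *: s).
Proof.
move=> us A; rewrite clZE; under eq_fun do rewrite clZE.
exact: series_cvgZ (us A).
Qed.

Lemma cl_has_sum_sum (I : Type) (r : seq I) (u : I -> nat -> Cl) (s : I -> Cl) :
  (forall i, cl_has_sum (u i) (s i)) ->
  cl_has_sum (fun k => \sum_(i <- r) u i k) (\sum_(i <- r) s i).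
Proof.
move=> us; elim: r => [|i r IH].
  rewrite big_nil; under eq_fun do rewrite big_nil.
  move=> A; rewrite cl0E (_ : series _ = cst 0); first exact: cvg_cst.
  by apply/funext => m; rewrite /series /= big1 // => k _; rewrite cl0E.
by rewrite big_cons; under eq_fun do rewrite big_cons; exact: cl_has_sumD.
Qed.

Lemma cl_has_sum_gen (l : 'I_n) u s : cl_has_sum u s ->
  cl_has_sum (fun k => cl_gen l * u k) (cl_gen l * s).
Proof.
move=> us A; rewrite cl_gen_mulE; under eq_fun do rewrite cl_gen_mulE.
exact: series_cvgZ (us _).
Qed.

Lemma cl_has_sum_vec (x : 'rV[R]_n.+1) u s : cl_has_sum u s ->
  cl_has_sum (fun k => vec_part x * u k) (vec_part x * s).
Proof.
move=> us; rewrite /vec_part mulr_suml.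
under eq_fun do rewrite mulr_suml.
apply: cl_has_sum_sum => l; rewrite -scalerAl.
by under eq_fun do rewrite -scalerAl; exact/cl_has_sumZ/cl_has_sum_gen.
Qed.

Definition cl_entire alpha := forall A, entire (fun k => alpha k A).

Definition cl_dcoef alpha : nat -> Cl := fun k => k.+1%:R *: alpha k.+1.

Lemma cl_dcoefE alpha A : (fun k => cl_dcoef alpha k A) = dcoef (fun k => alpha k A).
Proof. by apply/funext => k; rewrite clZE. Qed.

Lemma cl_entire_deriv alpha : cl_entire alpha -> cl_entire (cl_dcoef alpha).
Proof. by move=> ea A; rewrite cl_dcoefE; exact: entire_deriv. Qed.

Lemma cl_norm_ge (a : Cl) A : `|a A| <= cl_norm a.
Proof.
rewrite -[leRHS]ger0_norm ?sqrtr_ge0 // -ler_sqr ?nnegrE // !real_normK ?num_real //.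
rewrite cl_norm_sqr (bigD1 A) //= lerDl sumr_ge0 // => B _; exact: sqr_ge0.
Qed.

(** The terms [k! |alpha_k|^2] and [r^(2k) / k!] of convergent series are bounded, and together they
    bound [|alpha_k| r^k]. *)
Lemma fock_summable_entire alpha : fock_summable alpha -> cl_entire alpha.
Proof.
move=> sa A r r0.
have [M HM] := cvg_has_ub (cvgP _ (cvg_series_cvg_0 sa)).
have [N HN] := cvg_has_ub (cvgP _ (cvg_series_cvg_0 (is_cvg_series_exp_coeff (r ^+ 2)))).
exists (M + N) => k.
have Mk : k`!%:R * alpha k A ^+ 2 <= M.
  apply: le_trans (HM _ _); last by exists k.
  apply: le_trans (ler_norm _); rewrite ler_wpM2l //.
  rewrite -[leLHS]real_normK ?num_real //.
  by rewrite lerXn2r ?nnegrE ?sqrtr_ge0 ?cl_norm_ge.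
have Nk : r ^+ k ^+ 2 / k`!%:R <= N.
  apply: le_trans (HN _ _); last by exists k.
  by apply: le_trans (ler_norm _); rewrite /exp_coeff /= -!exprM mulnC.
apply: le_trans (lerD Mk Nk).
have f0 : 0 < k`!%:R :> R by rewrite ltr0n fact_gt0.
(* AM-GM: |c| r^k <= k! c^2 + r^(2k) / k! *)
rewrite -subr_ge0 -(pmulr_rge0 _ f0).
have -> : k`!%:R * (k`!%:R * alpha k A ^+ 2 + r ^+ k ^+ 2 / k`!%:R
    - `|alpha k A| * r ^+ k) = (k`!%:R * `|alpha k A| - r ^+ k / 2) ^+ 2 + 3 / 4 * r ^+ k ^+ 2.
  by rewrite -[alpha k A ^+ 2]real_normK ?num_real //; field; rewrite gt_eqF.
by rewrite addr_ge0 ?sqr_ge0 // mulr_ge0 ?sqr_ge0 // divr_ge0.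
Qed.

End CliffordSums.

(** * Sums of Appell series are axially monogenic *)

Section AppellSums.
Context {R : realType} {n : nat}.
Hypothesis n_gt0 : (0 < n)%N.
Local Notation Cl := (clifford R n).
Local Notation Pt := 'rV[R]_n.+1.
Implicit Types (alpha : nat -> Cl) (t p : R) (x : Pt).

Definition cl_sumE alpha t p : Cl := [ffun A => sumE n (fun k => alpha k A) t p].
Definition cl_sumO alpha t p : Cl := [ffun A => sumO n (fun k => alpha k A) t p].
Definition cl_sumW alpha t p : Cl := [ffun A => sumW n (fun k => alpha k A) t p].

Definition appell_sum alpha : Pt -> Cl := axial_fun (cl_sumE alpha) (cl_sumO alpha).

Lemma appell_sumP alpha x : cl_entire alpha ->
  cl_has_sum (fun k => appell k x * alpha k) (appell_sum alpha x).
Proof.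
move=> ea.
have hE : cl_has_sum (fun k => axE n (x 0 0) (vec_sqr x) k *: alpha k)
    (cl_sumE alpha (x 0 0) (vec_sqr x)).
  move=> A; rewrite ffunE; under eq_fun do rewrite clZE; exact: sumE_cvg.
have hO : cl_has_sum (fun k => axO n (x 0 0) (vec_sqr x) k *: alpha k)
    (cl_sumO alpha (x 0 0) (vec_sqr x)).
  move=> A; rewrite ffunE; under eq_fun do rewrite clZE; exact: sumO_cvg.
have := cl_has_sumD hE (cl_has_sum_vec (x := x) hO).
rewrite (_ : (fun k => _) = (fun k => appell k x * alpha k)) //.
apply/funext => k; rewrite appellE // mulrDl -scalerAl mul1r.
by rewrite -scalerAr -scalerAl.
Qed.

Lemma appell_sum_real alpha t A :
  appell_sum alpha (real_point n t) A = pser (fun k => alpha k A) t.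
Proof.
rewrite /appell_sum /axial_fun vec_part_real mul0r addr0 real_point0 vec_sqr_real.
by rewrite ffunE -pserE.
Qed.

Lemma cl_sumE_derive_t alpha t p : cl_entire alpha ->
  cl_derive (cl_sumE alpha ^~ p) t (cl_sumE (cl_dcoef alpha) t p).
Proof.
move=> ea A; rewrite ffunE cl_dcoefE.
by apply: is_derive_ext (sumE_derive_t n_gt0 t p (ea A)) => s; rewrite ffunE.
Qed.

Lemma cl_sumO_derive_t alpha t p : cl_entire alpha ->
  cl_derive (cl_sumO alpha ^~ p) t (cl_sumO (cl_dcoef alpha) t p).
Proof.
move=> ea A; rewrite ffunE cl_dcoefE.
by apply: is_derive_ext (sumO_derive_t n_gt0 t p (ea A)) => s; rewrite ffunE.
Qed.

Lemma cl_sumE_derive_p alpha t p : cl_entire alpha ->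
  cl_derive (cl_sumE alpha t) p (- 2^-1 *: cl_sumO (cl_dcoef alpha) t p).
Proof.
move=> ea A; rewrite clZE ffunE cl_dcoefE mulNr mulrC.
by apply: is_derive_ext (sumE_derive_p n_gt0 t p (ea A)) => s; rewrite ffunE.
Qed.

Lemma cl_sumO_derive_p alpha t p : cl_entire alpha ->
  cl_derive (cl_sumO alpha t) p (cl_sumW alpha t p).
Proof.
move=> ea A; rewrite ffunE.
by apply: is_derive_ext (sumO_derive_p n_gt0 t p (ea A)) => s; rewrite ffunE.
Qed.

Lemma cl_sumE_dcoef alpha t p : cl_entire alpha ->
  cl_sumE (cl_dcoef alpha) t p = n%:R *: cl_sumO alpha t p + (2 * p) *: cl_sumW alpha t p.
Proof.
move=> ea; apply/ffunP => A; rewrite clDE !clZE !ffunE cl_dcoefE.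
exact: sumE_deriv.
Qed.

Lemma appell_sum_derive0 alpha x A : cl_entire alpha ->
  is_derive x (unit_vec R ord0) (coord_fun (appell_sum alpha) A)
    (appell_sum (cl_dcoef alpha) x A).
Proof.
by move=> ea; apply: axial_derive0; [exact: cl_sumE_derive_t|exact: cl_sumO_derive_t].
Qed.

Lemma appell_sum_partial0 alpha x : cl_entire alpha ->
  partial ord0 (appell_sum alpha) x = appell_sum (cl_dcoef alpha) x.
Proof.
move=> ea; apply/ffunP => A; rewrite ffunE.
by have [_] := appell_sum_derive0 x A ea.
Qed.

(** By the two equations of the monogenicity system the vector Dirac operator is minus the
    [x_0]-derivative. Hence the hypercomplex derivative coincides with the [x_0]-derivative and
    lowers the degree. *)
Lemma appell_sum_dirac alpha x : cl_entire alpha ->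
  vec_dirac (appell_sum alpha) x = - appell_sum (cl_dcoef alpha) x.
Proof.
move=> ea; rewrite /appell_sum.
rewrite (vec_dirac_axial (cl_sumE_derive_p _ _ ea) (cl_sumO_derive_p _ _ ea)).
rewrite -scalerAr scalerA mulrN divff ?pnatr_eq0 // scaleN1r.
by rewrite /axial_fun cl_sumE_dcoef // -!opprD -addrA addrC.
Qed.

Lemma annihilation_appell_sum alpha : cl_entire alpha ->
  annihilation (appell_sum alpha) = appell_sum (cl_dcoef alpha).
Proof.
move=> ea; apply/funext => x; rewrite /annihilation appell_sum_partial0 //.
rewrite appell_sum_dirac // opprK; set z := appell_sum _ x.
have -> : z + z = 2 *: z by rewrite scaler_nat mulr2n.
by rewrite scalerA mulVf ?scale1r // pnatr_eq0.
Qed.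

Definition cl_continuous (F : Pt -> Cl) := forall A, continuous (fun x => F x A).

Lemma cl_continuousD F G : cl_continuous F -> cl_continuous G ->
  cl_continuous (fun x => F x + G x).
Proof.
move=> cF cG A; under eq_fun do rewrite clDE.
by move=> x; exact: cvgD (cF A x) (cG A x).
Qed.

Lemma cl_continuousZ (r : Pt -> R) F : continuous r -> cl_continuous F ->
  cl_continuous (fun x => r x *: F x).
Proof.
move=> cr cF A; under eq_fun do rewrite clZE.
by move=> x; exact: cvgM (cr x) (cF A x).
Qed.

Lemma cl_continuous_gen l F : cl_continuous F -> cl_continuous (fun x => cl_gen l * F x).
Proof.
move=> cF A; under eq_fun do rewrite cl_gen_mulE.
by move=> x; exact: cvgM (cvg_cst _) (cF _ x).
Qed.

Lemma continuous_sum (I : Type) (s : seq I) (f : I -> Pt -> R) :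
  (forall i, continuous (f i)) -> continuous (fun x => \sum_(i <- s) f i x).
Proof.
move=> cf; elim: s => [|i s IH].
  by under eq_fun do rewrite big_nil; exact: cst_continuous.
by under eq_fun do rewrite big_cons; move=> x; exact: cvgD (cf i x) (IH x).
Qed.

Lemma entry_continuous (i : 'I_n.+1) : continuous (fun x : Pt => x 0 i).
Proof. exact: coord_continuous. Qed.

Lemma cl_continuous_vec F : cl_continuous F -> cl_continuous (fun x => vec_part x * F x).
Proof.
move=> cF A; under eq_fun do rewrite vec_part_mulE.
apply: continuous_sum => l x.
exact: (cvgM (@entry_continuous _ x) (@cl_continuous_gen l F cF A x)).
Qed.

Lemma vec_sqr_continuous : continuous (@vec_sqr R n).
Proof.
apply: continuous_sum => l x.
exact: (cvgM (@entry_continuous _ x) (@entry_continuous _ x)).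
Qed.

Lemma cl_sumE_continuous alpha : cl_entire alpha ->
  cl_continuous (fun x => cl_sumE alpha (x 0 0) (vec_sqr x)).
Proof.
move=> ea A; under eq_fun do rewrite ffunE.
by apply: sumE_continuous => //; [exact: entry_continuous|exact: vec_sqr_continuous].
Qed.

Lemma cl_sumO_continuous alpha : cl_entire alpha ->
  cl_continuous (fun x => cl_sumO alpha (x 0 0) (vec_sqr x)).
Proof.
move=> ea A; under eq_fun do rewrite ffunE.
by apply: sumO_continuous => //; [exact: entry_continuous|exact: vec_sqr_continuous].
Qed.

Lemma cl_sumW_continuous alpha : cl_entire alpha ->
  cl_continuous (fun x => cl_sumW alpha (x 0 0) (vec_sqr x)).
Proof.
move=> ea A; under eq_fun do rewrite ffunE.
by apply: sumW_continuous => //; [exact: entry_continuous|exact: vec_sqr_continuous].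
Qed.

Lemma appell_sum_continuous alpha : cl_entire alpha -> cl_continuous (appell_sum alpha).
Proof.
move=> ea; apply: cl_continuousD; first exact: cl_sumE_continuous.
exact/cl_continuous_vec/cl_sumO_continuous.
Qed.

Lemma appell_sum_C1 alpha : cl_entire alpha -> class_C1 (appell_sum alpha).
Proof.
move=> ea i A; case: (unliftP ord0 i) => [l|] ->.
  have D x := axial_derive_lift l A (cl_sumE_derive_p (x 0 0) (vec_sqr x) ea)
    (cl_sumO_derive_p (x 0 0) (vec_sqr x) ea).
  split=> [x|]; first by have [] := D x.
  pose G x := (2 * x 0 (lift ord0 l)) *:
      (- 2^-1 *: cl_sumO (cl_dcoef alpha) (x 0 0) (vec_sqr x)
      + vec_part x * cl_sumW alpha (x 0 0) (vec_sqr x))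
    + cl_gen l * cl_sumO alpha (x 0 0) (vec_sqr x).
  rewrite (_ : 'D_ _ _ = fun x => G x A); last first.
    by apply/funext => x; have [_] := D x.
  apply: cl_continuousD; last exact/cl_continuous_gen/cl_sumO_continuous.
  apply: cl_continuousZ.
    move=> x; exact: (cvgM (cvg_cst _) (@entry_continuous _ x)).
  apply: cl_continuousD; last exact/cl_continuous_vec/cl_sumW_continuous.
  apply: cl_continuousZ; first by exact: cst_continuous.
  exact/cl_sumO_continuous/cl_entire_deriv.
split=> [x|]; first by have [] := appell_sum_derive0 x A ea.
rewrite (_ : 'D_ _ _ = fun x => appell_sum (cl_dcoef alpha) x A).
  exact/appell_sum_continuous/cl_entire_deriv.
by apply/funext => x; have [_] := appell_sum_derive0 x A ea.
Qed.

Lemma appell_sum_monogenic alpha : cl_entire alpha -> monogenic (appell_sum alpha).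
Proof.
move=> ea; split; first exact: appell_sum_C1.
by move=> x; rewrite appell_sum_partial0 // appell_sum_dirac // subrr.
Qed.

Lemma appell_sum_axial_form alpha : axial_form (appell_sum alpha).
Proof.
exists (fun u v => cl_sumE alpha u (v ^+ 2)), (fun u v => v *: cl_sumO alpha u (v ^+ 2)).
split=> [u v|u v|x r]; first by rewrite sqrrN.
  by rewrite sqrrN scaleNr.
have r2 : r ^+ 2 = vec_sqr x by rewrite /r cl_norm_vec_part sqr_sqrtr ?vec_sqr_ge0.
rewrite r2 -scalerAl -scalerAr scalerA /appell_sum /axial_fun; congr (_ + _).
(* Off the real line the factor [v] in the odd component cancels [r^-1]; on it the vector part
   vanishes. *)
have [r0|r0] := eqVneq r 0; last by rewrite mulVf // scale1r.
suff -> : vec_part x = 0 by rewrite !mul0r scaler0.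
apply/ffunP => A; have := cl_norm_ge (vec_part x) A.
by rewrite -/r r0 normr_le0 cl0E => /eqP.
Qed.

End AppellSums.

(** * Interchange of summation in triangular double series *)

Section TriangularSums.
Context {R : realType}.

Lemma sum_nat_eq0 (a b : nat) (f : nat -> R) :
  (forall j, (a <= j < b)%N -> f j = 0) -> \sum_(a <= j < b) f j = 0.
Proof.
by move=> f0; rewrite big_nat_cond big1 // => j; rewrite andbT; exact: f0.
Qed.

Lemma series_sum_cvg (m : nat) (w : nat -> nat -> R) (h : nat -> R) :
  (forall j, series (w^~ j) @ \oo --> h j) ->
  series (fun k => \sum_(j < m) w k j) @ \oo --> \sum_(j < m) h j.
Proof.
move=> wh; elim: m => [|m IH].
  rewrite big_ord0 (_ : series _ = cst 0); first exact: cvg_cst.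
  by apply/funext => k; rewrite /series /= big1 // => i _; rewrite big_ord0.
rewrite big_ord_recr /=; under eq_fun do rewrite big_ord_recr /=.
exact: series_cvgD.
Qed.

(** A Fubini statement: row sums can be replaced by column sums when the absolute row sums are
    dominated by a summable [B]. *)
Lemma triangular_sum (w : nat -> nat -> R) (B h : nat -> R) (s : R) :
  cvgn (series B) -> (forall k m, \sum_(j < m) `|w k j| <= B k) ->
  (forall k j, (k < j)%N -> w k j = 0) ->
  (forall j, series (w^~ j) @ \oo --> h j) ->
  series (fun k => \sum_(j < k.+1) w k j) @ \oo --> s ->
  series h @ \oo --> s.
Proof.
move=> cB wB w0 wh ws.
have B0 k : 0 <= B k by have := wB k 0; rewrite big_ord0.
have tail m k : (k < m)%N -> \sum_(j < m) w k j = \sum_(j < k.+1) w k j.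
  move=> km; rewrite -(big_mkord xpredT (w k)) (big_cat_nat _ (n := k.+1)) //=.
  by rewrite big_mkord sum_nat_eq0 ?addr0 // => j /andP[kj _]; exact: w0.
(* Rows [k < m] lie entirely within the first [m] columns and cancel; every later row contributes at
   most [2 * B k]. *)
have key m : `|s - series h m| <= 2 * (limn (series B) - series B m).
  have c1 : series (fun k => \sum_(j < k.+1) w k j + -1 * \sum_(j < m) w k j) @ \oo -->
      s - series h m.
    rewrite -[- series h m]mulN1r; apply: series_cvgD => //; apply: series_cvgZ.
    by rewrite /series /= big_mkord; exact: series_sum_cvg.
  have c2 : (fun N =>
      `|series (fun k => \sum_(j < k.+1) w k j + -1 * \sum_(j < m) w k j) N|) @ \oo -->
      `|s - series h m| by exact: cvg_norm.
  have c3 : (fun N => 2 * (series B N - series B m)) @ \oo -->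
      2 * (limn (series B) - series B m).
    by apply: cvgMl_tmp; apply: cvgB => //; exact: cvg_cst.
  rewrite -(cvg_lim (@Rhausdorff R) c2) -[leRHS](cvg_lim (@Rhausdorff R) c3).
  apply: ler_lim; [exact: cvgP c2|exact: cvgP c3|].
  near=> N.
  have mN : (m <= N)%N by near: N; exists m.
  rewrite sub_series_geq // {1}/series /= (big_cat_nat _ (n := m)) //=.
  rewrite sum_nat_eq0 ?add0r => [|k /andP[_ km]]; last by rewrite (tail m) // mulN1r subrr.
  rewrite mulr_sumr; apply: le_trans (ler_norm_sum _ _ _) _.
  apply: ler_sum => k _; rewrite mulN1r mulr_natl mulr2n.
  apply: le_trans (ler_normB _ _) _.
  by apply: lerD; apply: le_trans (ler_norm_sum _ _ _) (wB _ _).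
have lim0 : (fun m => 2 * (limn (series B) - series B m)) @ \oo --> (0 : R).
  rewrite -[X in _ --> X](mulr0 2); apply: cvgMl_tmp.
  by rewrite -[X in _ --> X](subrr (limn (series B))); apply: cvgB => //; exact: cvg_cst.
apply/cvgrPdist_le => e e0.
have /cvgrPdist_le/(_ e e0) := lim0; apply: filterS => m; rewrite sub0r normrN.
by apply: le_trans; apply: le_trans (key m) (ler_norm _).
Unshelve. all: by end_near. Qed.

Lemma binomial_le_exp (a b : R) (m i : nat) : 0 <= a -> 0 <= b ->
  \sum_(j < m) 'C(i, j)%:R * a ^+ (i - j) * b ^+ j <= (a + b) ^+ i.
Proof.
move=> a0 b0; rewrite exprDn.
have pos (j : nat) : 0 <= 'C(i, j)%:R * a ^+ (i - j) * b ^+ j.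
  by rewrite !mulr_ge0 ?exprn_ge0.
rewrite (eq_bigr (fun j : 'I_i.+1 => 'C(i, j)%:R * a ^+ (i - j) * b ^+ j)); last first.
  by move=> j _; rewrite -mulr_natl mulrA.
rewrite -(big_mkord xpredT (fun j => 'C(i, j)%:R * a ^+ (i - j) * b ^+ j)).
rewrite -[leRHS](big_mkord xpredT (fun j => 'C(i, j)%:R * a ^+ (i - j) * b ^+ j)).
have [mi|im] := leqP m i.+1.
  by rewrite [leRHS](big_cat_nat _ (n := m)) //= lerDl sumr_ge0.
rewrite (big_cat_nat _ (n := i.+1)) //=; last exact: ltnW.
rewrite [X in _ + X]sum_nat_eq0 ?addr0 // => j /andP[ij _].
by rewrite bin_small // !mul0r.
Qed.

Lemma binomial_le_exp1 (a : R) (m i : nat) : 0 <= a ->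
  'C(i, m)%:R * a ^+ (i - m) <= (a + 1) ^+ i.
Proof.
move=> a0; apply: le_trans (binomial_le_exp m.+1 i a0 ler01).
rewrite big_ord_recr /= expr1n mulr1 lerDr sumr_ge0 // => j _.
by rewrite expr1n mulr1 mulr_ge0 ?exprn_ge0.
Qed.

(** The binomial theorem followed by [triangular_sum]; it supplies the local expansions that
    [real_analytic] asks for. *)
Lemma pser_recenter (c : nat -> R) (a s : R) : entire c ->
  series (fun m => s ^+ m * wsum (fun i => 'C(i, m)%:R * a ^+ (i - m)) c) @ \oo -->
  pser c (a + s).
Proof.
move=> ec.
apply: (@triangular_sum (fun i m => s ^+ m * ('C(i, m)%:R * a ^+ (i - m) * c i))
  (fun i => (`|a| + `|s|) ^+ i * `|c i|)).
- by apply: entire_summable => //; rewrite addr_ge0.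
- move=> i m; rewrite (eq_bigr
    (fun j : 'I_m => 'C(i, j)%:R * `|a| ^+ (i - j) * `|s| ^+ j * `|c i|)).
    by rewrite -mulr_suml ler_wpM2r // binomial_le_exp.
  by move=> j _; rewrite !normrM !normrX normr_nat; ring.
- by move=> i m im; rewrite bin_small // !mul0r mulr0.
- move=> m; apply: series_cvgZ; apply: wsum_cvg.
  apply: (@entire_cvg _ _ _ 1 (`|a| + 1)) => // i.
  by rewrite mul1r normrM normr_nat normrX binomial_le_exp1.
- have := pser_cvg (t := a + s) ec.
  rewrite (_ : (fun k => (a + s) ^+ k * c k) =
    (fun k => \sum_(j < k.+1) s ^+ j * ('C(k, j)%:R * a ^+ (k - j) * c k))) //.
  apply/funext => k; rewrite exprDn mulr_suml; apply: eq_bigr => j _.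
  by rewrite -mulr_natl; ring.
Qed.

Lemma series_shift0n (u : nat -> R) (l : R) (m : nat) :
  (forall k, (k < m)%N -> u k = 0) ->
  series (fun k => u (k + m)%N) @ \oo --> l -> series u @ \oo --> l.
Proof.
elim: m u => [|m IH] u u0 ul.
  by rewrite (_ : u = fun k => u (k + 0)%N) //; apply/funext => k; rewrite addn0.
apply/series_shift0; first exact: u0.
apply: IH => [k km|]; first exact: u0.
by move: ul; under eq_fun do rewrite addnS.
Qed.

End TriangularSums.

(** * Existence of GCK extensions: regrouping by powers of the vector part *)

Section GCKExpansion.
Context {R : realType} {n : nat}.
Hypothesis n_gt0 : (0 < n)%N.
Local Notation Cl := (clifford R n).
Local Notation Pt := 'rV[R]_n.+1.
Implicit Types (alpha : nat -> Cl) (t : R) (x : Pt) (k j : nat).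

(* appell k x is the sum of gck_coef k j * x_0^(k - j) * (vec_part x)^j over  *)
(* j <= k; see appell_gck.                                                    *)
Fixpoint gck_coef k j : R :=
  match k, j with
  | 0, 0 => 1
  | 0, _.+1 => 0
  | k'.+1, 0 => gck_coef k' 0
  | k'.+1, j'.+1 => (if odd j'.+1 then odd_weight n k' else 1)
                    * (gck_coef k' j'.+1 + gck_coef k' j')
  end.

(** The recursion is that of Pascal's triangle with extra factors in [[0, 1]]. *)
Lemma gck_coef_itv k j : 0 <= gck_coef k j <= 'C(k, j)%:R.
Proof.
elim: k j => [|k IH] [|j]; rewrite ?bin0 ?lexx ?ler01 //=.
  by have := IH 0; rewrite bin0.
have [/andP[a0 aC] /andP[b0 bC]] := (IH j.+1, IH j).
have ab : gck_coef k j.+1 + gck_coef k j <= 'C(k.+1, j.+1)%:R.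
  by rewrite binS natrD lerD.
case: ifP => _; last by rewrite mul1r addr_ge0.
have /andP[w0 w1] := odd_weight_itv (R := R) n_gt0 k.
rewrite mulr_ge0 ?addr_ge0 //=; apply: le_trans ab.
by rewrite ler_piMl ?addr_ge0.
Qed.

Lemma gck_coef_small k j : (k < j)%N -> gck_coef k j = 0.
Proof.
move=> kj; have := gck_coef_itv k j; rewrite bin_small // => /andP[h1 h2].
by apply/eqP; rewrite eq_le h2.
Qed.

Definition gck_term x k j : Cl := (gck_coef k j * x 0 0 ^+ (k - j)) *: vec_part x ^+ j.

Lemma gck_termS0 x k : gck_term x k.+1 0 = x 0 0 *: gck_term x k 0.
Proof. by rewrite /gck_term scalerA /= !subn0 exprS mulrCA. Qed.

Lemma gck_termSS x k j : gck_term x k.+1 j.+1 = (if odd j.+1 then odd_weight n k else 1)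
  *: (x 0 0 *: gck_term x k j.+1 + vec_part x * gck_term x k j).
Proof.
rewrite /gck_term -scalerAr -exprS scalerA -scalerDl scalerA subSS /=.
congr (_ *: _); rewrite -mulrA; congr (_ * _).
have [jk|kj] := ltnP j k; last by rewrite gck_coef_small //; ring.
by rewrite -(subnSK jk) exprS; ring.
Qed.

Lemma gck_term_small x k j : (k < j)%N -> gck_term x k j = 0.
Proof. by move=> kj; rewrite /gck_term gck_coef_small // mul0r scale0r. Qed.

(** Even powers of the vector part are real and make up [axE], odd powers make up [axO] times the
    vector part. One step of [gck_coef] is one step of [ax_pair], the damping falling on the odd
    powers. *)
Lemma gck_parity x k :
  \sum_(j < k.+1) (~~ odd j)%:R *: gck_term x k j = (axE n (x 0 0) (vec_sqr x) k)%:A /\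
  \sum_(j < k.+1) (odd j)%:R *: gck_term x k j = axO n (x 0 0) (vec_sqr x) k *: vec_part x.
Proof.
set t := x 0 0; set b := vec_part x.
elim: k => [|k [IHE IHO]].
  by rewrite !big_ord1 /= /gck_term /= !mul1r !scale1r axO0 !scale0r expr0.
pose E := \sum_(j < k.+2) (~~ odd j)%:R *: gck_term x k j.
pose O := \sum_(j < k.+2) (odd j)%:R *: gck_term x k j.
have EE : E = (axE n t (vec_sqr x) k)%:A.
  by rewrite /E big_ord_recr /= gck_term_small // scaler0 addr0.
have OE : O = axO n t (vec_sqr x) k *: b.
  by rewrite /O big_ord_recr /= gck_term_small // scaler0 addr0.
split.
  have -> : \sum_(j < k.+2) (~~ odd j)%:R *: gck_term x k.+1 j =
      t *: E + b * \sum_(j < k.+1) (odd j)%:R *: gck_term x k j.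
    rewrite /E big_ord_recl [in RHS]big_ord_recl /= gck_termS0 !scale1r.
    rewrite scalerDr -addrA; congr (_ + _).
    rewrite scaler_sumr mulr_sumr -big_split /=; apply: eq_bigr => j _.
    rewrite gck_termSS /= negbK; case: (odd j); rewrite /= ?scale1r -?scalerAr ?scale1r //.
    by rewrite !scale0r scaler0 addr0.
  rewrite EE IHO -scalerAr vec_part_sqr !scalerA -scalerDl axES; congr (_ *: _); ring.
have -> : \sum_(j < k.+2) (odd j)%:R *: gck_term x k.+1 j =
    odd_weight n k *: (t *: O + b * \sum_(j < k.+1) (~~ odd j)%:R *: gck_term x k j).
  rewrite /O big_ord_recl [in RHS]big_ord_recl /= !scale0r !add0r.
  rewrite scalerDr !scaler_sumr mulr_sumr scaler_sumr -big_split /=.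
  apply: eq_bigr => j _.
  rewrite gck_termSS /=; case: (odd j); rewrite /= ?scale1r -?scalerAr ?scale1r ?scale0r.
    by rewrite !scaler0 addr0.
  by rewrite scalerDr.
rewrite OE IHE -scalerAr mulr1 !scalerA -scalerDl scalerA axOS; congr (_ *: _); ring.
Qed.

Lemma appell_gck x k : appell k x = \sum_(j < k.+1) gck_term x k j.
Proof.
have [E O] := gck_parity x k.
rewrite appellE // -E -O -big_split; apply: eq_bigr => j _ /=.
by rewrite -scalerDl; case: (odd j); rewrite ?addr0 ?add0r scale1r.
Qed.

(** This norm is invariant under left multiplication by a generator, which permutes the coordinates
    up to sign; so powers of the vector part are easy to bound. *)
Definition cl_l1 (a : Cl) : R := \sum_A `|a A|.

Lemma cl_l1_ge (a : Cl) A : `|a A| <= cl_l1 a.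
Proof. by rewrite /cl_l1 (bigD1 A) //= lerDl sumr_ge0. Qed.

Lemma cl_l1_vec x (a : Cl) :
  cl_l1 (vec_part x * a) <= (\sum_(l < n) `|x 0 (lift ord0 l)|) * cl_l1 a.
Proof.
have gen l : cl_l1 (cl_gen l * a) = cl_l1 a.
  rewrite /cl_l1 [RHS](reindex_inj (can_inj (symdiffKs [set l]%SET))) /=.
  apply: eq_bigr => A _; rewrite cl_gen_mulE normrM.
  suff -> : `|clsign [set l]%SET (symdiff [set l]%SET A)| = 1 :> R by rewrite mul1r.
  apply/eqP; rewrite -(@eqrXn2 _ 2) // expr1n -normrX ger0_norm ?sqr_ge0 //.
  by rewrite expr2 clsign_sqr.
rewrite [leRHS]mulr_suml; under [leRHS]eq_bigr => l _ do rewrite -(gen l) /cl_l1 mulr_sumr.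
rewrite exchange_big /=; apply: ler_sum => A _; rewrite vec_part_mulE.
apply: le_trans (ler_norm_sum _ _ _) _.
by apply: ler_sum => l _; rewrite normrM.
Qed.

Lemma cl_l1_vecX x (a : Cl) j :
  cl_l1 (vec_part x ^+ j * a) <= (\sum_(l < n) `|x 0 (lift ord0 l)|) ^+ j * cl_l1 a.
Proof.
elim: j => [|j IH]; first by rewrite !expr0 !mul1r.
rewrite !exprS -!mulrA; apply: le_trans (cl_l1_vec _ _) _.
by rewrite ler_wpM2l // sumr_ge0.
Qed.

Definition gck_series_coef alpha j A : nat -> R :=
  fun i => gck_coef (i + j) j * alpha (i + j)%N A.

Lemma entire_gck_series_coef alpha j A : cl_entire alpha ->
  entire (gck_series_coef alpha j A).
Proof.
move=> ea.
apply: (@entire_shiftn _ (fun k => gck_coef k j * alpha k A)).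
apply: (@entire_le _ _ _ 1 2) (ea A) => // k; rewrite mul1r normrM ler_wpM2r //.
have /andP[q0 qC] := gck_coef_itv k j; rewrite ger0_norm //.
apply: le_trans qC _; have := @binomial_le_exp1 R 1 j k ler01.
by rewrite expr1n mulr1.
Qed.

Definition gck_layer alpha j t : Cl := [ffun A => pser (gck_series_coef alpha j A) t].

Lemma gck_layer_analytic alpha j : cl_entire alpha -> real_analytic (gck_layer alpha j).
Proof.
move=> ea a.
exists (fun m => [ffun A =>
  wsum (fun i => 'C(i, m)%:R * a ^+ (i - m)) (gck_series_coef alpha j A)]).
exists 1 => // t _ A; rewrite ffunE.
under eq_fun do rewrite clZE ffunE.
have := @pser_recenter R _ a (t - a) (entire_gck_series_coef j A ea).
by have -> : a + (t - a) = t by rewrite addrC subrK.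
Qed.

Lemma gck_layer_sum alpha j t : cl_entire alpha ->
  cl_has_sum (fun k => (gck_coef k j * t ^+ (k - j)) *: alpha k) (gck_layer alpha j t).
Proof.
move=> ea A; rewrite ffunE; apply: (@series_shift0n _ _ _ j) => [k kj|].
  by rewrite clZE gck_coef_small // !mul0r.
have := pser_cvg (t := t) (entire_gck_series_coef j A ea).
rewrite (_ : (fun k => _) =
  (fun k => ((gck_coef (k + j) j * t ^+ (k + j - j)) *: alpha (k + j)%N) A)) //.
by apply/funext => k; rewrite clZE addnK /gck_series_coef; ring.
Qed.

Lemma cl_has_sum_vecX x (u : nat -> Cl) (z : Cl) j : cl_has_sum u z ->
  cl_has_sum (fun k => vec_part x ^+ j * u k) (vec_part x ^+ j * z).
Proof.
elim: j u z => [|j IH] u z uz.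
  by rewrite expr0 mul1r; under eq_fun do rewrite mul1r.
rewrite exprSr -mulrA; under eq_fun do rewrite -mulrA.
exact/IH/cl_has_sum_vec.
Qed.

(** Each [appell k x] is expanded by [appell_gck] and the sums over the degree and over the power of
    the vector part are interchanged. Comparison with the binomial coefficients bounds row [k] by
    [(|t| + r)^k] times the norm of [alpha k]. *)
Lemma appell_sum_layers alpha x : cl_entire alpha ->
  cl_has_sum (fun j => vec_part x ^+ j * gck_layer alpha j (x 0 0)) (appell_sum alpha x).
Proof.
move=> ea A; set b := vec_part x; set t := x 0 0.
pose r : R := \sum_(l < n) `|x 0 (lift ord0 l)|.
have r0 : 0 <= r by rewrite sumr_ge0.
have el1 : entire (fun k => cl_l1 (alpha k)).
  apply: entire_sum => B; apply: (@entire_le _ _ _ 1 1) (ea B) => // k.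
  by rewrite expr1n !mul1r normr_id.
apply: (@triangular_sum _ (fun k j => (gck_term x k j * alpha k) A)
   (fun k => (`|t| + r) ^+ k * `|cl_l1 (alpha k)|)).
- by apply: entire_summable => //; rewrite addr_ge0.
- move=> k m.
  have l0 : 0 <= cl_l1 (alpha k) by rewrite sumr_ge0.
  rewrite [`|cl_l1 _|]ger0_norm //.
  apply: le_trans
    (_ : (\sum_(j < m) 'C(k, j)%:R * `|t| ^+ (k - j) * r ^+ j) * cl_l1 (alpha k) <= _).
    rewrite mulr_suml; apply: ler_sum => j _.
    rewrite /gck_term -scalerAl clZE !normrM -!mulrA.
    have /andP[q0 qC] := gck_coef_itv k j.
    rewrite normrX (ger0_norm q0) ler_pM ?mulr_ge0 ?exprn_ge0 //.
    rewrite ler_wpM2l ?exprn_ge0 //.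
    by apply: le_trans (cl_l1_ge _ _) (cl_l1_vecX _ _ _).
  by rewrite ler_wpM2r // binomial_le_exp.
- by move=> k j kj; rewrite gck_term_small // mul0r cl0E.
- move=> j.
  have H : cl_has_sum (fun k => gck_term x k j * alpha k) (b ^+ j * gck_layer alpha j t).
    rewrite (_ : (fun k => _) =
        (fun k => b ^+ j * ((gck_coef k j * t ^+ (k - j)) *: alpha k))).
      exact/cl_has_sum_vecX/gck_layer_sum.
    by apply/funext => k; rewrite /gck_term -scalerAl -scalerAr.
  exact: H.
- have := appell_sumP n_gt0 (x := x) ea => /(_ A).
  by under eq_fun do rewrite appell_gck mulr_suml cl_coord_sum.
Qed.

Lemma appell_sum_is_gck alpha : cl_entire alpha ->
  is_gck (fun t => appell_sum alpha (real_point n t)) (appell_sum alpha).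
Proof.
move=> ea; split=> //.
  by split; [exact: appell_sum_monogenic|exact: appell_sum_axial_form].
exists (gck_layer alpha); split; first by move=> j; exact: gck_layer_analytic.
by move=> x; exact: appell_sum_layers.
Qed.

End GCKExpansion.

(** * Continuity of real-analytic functions *)

Section RealAnalytic.
Context {R : realType} {n : nat}.
Local Notation Cl := (clifford R n).

Lemma real_analytic_continuous (h : R -> Cl) A :
  real_analytic h -> continuous (fun t => h t A).
Proof.
move=> ah a; have [c [e e0 hc]] := ah a.
pose d k := c k A.
have ds t : `|t - a| < e -> series (fun k => (t - a) ^+ k * d k) @ \oo --> h t A.
  by move=> /hc /(_ A); under eq_fun do rewrite clZE.
have ha : h a A = d 0.
  have := ds a; rewrite subrr normr0 => /(_ e0) H.
  rewrite -(cvg_lim (@Rhausdorff R) H); apply: cvg_lim => //.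
  rewrite -cvg_shiftS (_ : [sequence _]_m = cst (d 0)); first exact: cvg_cst.
  apply/funext => m; rewrite /series /= big_nat_recl //= expr0 mul1r big1 ?addr0 // => k _.
  by rewrite exprS !mul0r.
(* Convergence at [a + e / 2] bounds the coefficients, so for [|t - a| <= e / 4] the series is
   dominated by a geometric one of ratio 1/2. *)
have [M dM] : exists M, forall k, `|d k| * (e / 2) ^+ k <= M.
  have ae : `|a + e / 2 - a| < e by rewrite addrAC subrr add0r ger0_norm; lra.
  have [M HM] := cvg_has_ub (cvgP _ (cvg_series_cvg_0 (cvgP _ (ds _ ae)))).
  exists M => k; apply: le_trans (HM _ _); last by exists k.
  by rewrite /= addrAC subrr add0r normrM mulrC normrX [`|e / 2|]ger0_norm //; lra.
have M0 : 0 <= M by apply: le_trans (dM 0); rewrite expr0 mulr1.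
have key t : `|t - a| <= e / 4 -> `|h a A - h t A| <= `|t - a| * (4 * M / e).
  move=> te; set s := t - a in te *.
  have se : `|t - a| < e by apply: le_lt_trans te _; lra.
  have cs : series (fun k => s ^+ k.+1 * d k.+1) @ \oo --> h t A - h a A.
    have := ds t se; rewrite -/s -cvg_shiftS => H.
    rewrite (_ : series _ = fun m => series (fun k => s ^+ k * d k) m.+1 - h a A).
      by apply: cvgB => //; exact: cvg_cst.
    apply/funext => m; rewrite ha /series /= [in RHS]big_nat_recl //= expr0 mul1r.
    by rewrite addrAC subrr add0r.
  have bd k : `|s ^+ k.+1 * d k.+1| <= geometric (`|s| * (2 * M / e)) (1 / 2) k.
    rewrite /geometric /= normrM normrX exprS -[leLHS]mulrA -[leRHS]mulrA ler_wpM2l //.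
    have := dM k.+1; rewrite exprS.
    have -> : 2 * M / e * (1 / 2) ^+ k = M / (e / 2 * (e / 2) ^+ k) * (e / 4) ^+ k.
      rewrite (_ : e / 4 = (e / 2) * (1 / 2)) ?exprMn; last by field.
      by field; rewrite ?expf_neq0 ?gt_eqF ?divr_gt0.
    move=> dMk; rewrite mulrC; apply: ler_pM => //.
      by rewrite ler_pdivlMr // mulr_gt0 ?exprn_gt0 // divr_gt0.
    by rewrite lerXn2r ?nnegrE //; lra.
  have half : `|1 / 2 : R| < 1 by rewrite ger0_norm; lra.
  have cg := is_cvg_geometric_series (a := `|s| * (2 * M / e)) half.
  have cn : cvgn [normed series (fun k => s ^+ k.+1 * d k.+1)].
    apply: series_le_cvg bd cg => k //=.
    by rewrite mulr_ge0 ?exprn_ge0 // mulr_ge0 // divr_ge0 ?mulr_ge0 // ltW.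
  rewrite distrC -(cvg_lim (@Rhausdorff R) cs).
  apply: le_trans (lim_series_norm cn) _.
  apply: le_trans (lim_series_le cn cg bd) _.
  rewrite (cvg_lim (@Rhausdorff R) (cvg_geometric_series half)).
  by rewrite (_ : _ / _ = `|s| * (4 * M / e)) //; field; lra.
have Na x : 0 < x -> \forall t \near a, `|a - t| <= x.
  by move=> x0; apply/nbhs_ballP; exists x => //= t; rewrite /ball /= => /ltW.
have C0 : 0 < 4 * M / e + 1.
  by rewrite ltr_wpDl // divr_ge0 ?mulr_ge0 // ltW.
apply/cvgrPdist_le => x x0.
near=> t.
have t4 : `|t - a| <= e / 4.
  by rewrite distrC; near: t; apply: Na; lra.
apply: le_trans (key t t4) _.
apply: (@le_trans _ _ (`|t - a| * (4 * M / e + 1))).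
  by rewrite ler_wpM2l // lerDl.
rewrite -ler_pdivlMr // distrC; near: t.
by apply: Na; rewrite divr_gt0.
Unshelve. all: by end_near. Qed.

End RealAnalytic.

(** * Clifford-valued power series and their leading coefficients *)

Section CliffordPowerSeries.
Context {R : realType} {n : nat}.
Local Notation Cl := (clifford R n).
Implicit Types (c : nat -> Cl) (p : R).

Definition cl_pser c p : Cl := [ffun A => pser (fun k => c k A) p].

Lemma cl_pser_sum c p : cl_entire c -> cl_has_sum (fun k => p ^+ k *: c k) (cl_pser c p).
Proof.
by move=> ec A; rewrite ffunE; under eq_fun do rewrite clZE; exact: pser_cvg.
Qed.

Lemma cl_pser_derive c p : cl_entire c ->
  cl_derive (cl_pser c) p (cl_pser (cl_dcoef c) p).
Proof.
move=> ec A; rewrite ffunE cl_dcoefE.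
by apply: is_derive_ext (pser_derive p (ec A)) => s; rewrite ffunE.
Qed.

Lemma cl_pser0 c : cl_entire c -> cl_pser c 0 = c 0.
Proof. by move=> ec; apply/ffunP => A; rewrite ffunE pser0. Qed.

Lemma cl_entire_nat c : cl_entire c -> cl_entire (fun k => k%:R *: c k).
Proof.
move=> ec A; apply: (@entire_le _ _ _ 1 2) (ec A) => // k.
by rewrite clZE mul1r normrM normr_nat ler_wpM2r // natr_le_exp2.
Qed.

Lemma cl_pser_dcoef c p : cl_entire c ->
  p *: cl_pser (cl_dcoef c) p = cl_pser (fun k => k%:R *: c k) p.
Proof.
move=> ec; apply/ffunP => A; rewrite clZE !ffunE.
rewrite [RHS]pserS; last exact: (cl_entire_nat ec A).
by rewrite clZE mul0r add0r.
Qed.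

Lemma cl_pser_lead c m (r : nat -> R) A : cl_entire c ->
  (forall i, (i < m)%N -> c i = 0) -> (forall k, r k != 0) -> r @ \oo --> 0 ->
  (fun k => cl_pser c (r k) A / r k ^+ m) @ \oo --> c m A.
Proof.
move=> ec c0 r0 rl; under eq_fun do rewrite ffunE.
by apply: (pser_lead (ec A)) => // i im; rewrite c0 // cl0E.
Qed.

Lemma cl_pser_lead_gen (l : 'I_n) c m (r : nat -> R) A : cl_entire c ->
  (forall i, (i < m)%N -> c i = 0) -> (forall k, r k != 0) -> r @ \oo --> 0 ->
  (fun k => (cl_gen l * cl_pser c (r k)) A / r k ^+ m) @ \oo --> (cl_gen l * c m) A.
Proof.
move=> ec c0 r0 rl; rewrite cl_gen_mulE; under eq_fun do rewrite cl_gen_mulE -mulrA.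
apply: cvgMl_tmp; exact: (cl_pser_lead ec c0 r0 rl).
Qed.

Lemma cl_gen_mul_eq0 (l : 'I_n) (a : Cl) : cl_gen l * a = 0 -> a = 0.
Proof.
move=> la; have : cl_gen l * (cl_gen l * a) = 0 by rewrite la mulr0.
by rewrite mulrA -[cl_gen l * _]expr2 cl_gen_sqr mulN1r => /eqP; rewrite oppr_eq0 => /eqP.
Qed.

End CliffordPowerSeries.

Section EvenOdd.
Context {R : realType}.

Lemma series_pairs (u : nat -> R) (s : R) : series u @ \oo --> s ->
  series (fun m => u m.*2 + u m.*2.+1) @ \oo --> s.
Proof.
move=> us; rewrite (_ : series _ = series u \o double).
  apply: cvg_comp us; apply/cvgnyPge => N; exists N => // m /= Nm.
  by rewrite -addnn; apply: leq_trans Nm (leq_addr _ _).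
apply/funext => m; rewrite /= /series /=; elim: m => [|m IH].
  by rewrite !big_geq.
by rewrite doubleS !big_nat_recr //= IH addrA.
Qed.

Lemma cvg_seq_ext (u v : nat -> R) (l l' : R) : u =1 v -> l = l' ->
  v @ \oo --> l' -> u @ \oo --> l.
Proof. by move=> /funext -> ->. Qed.

Lemma derive_limit_eq0 (u du : nat -> R -> R) (phi : R -> R) :
  (forall (m : nat) (t : R), is_derive t (1 : R) (u m) (du m t)) ->
  (forall m, continuous (du m)) -> continuous phi ->
  (forall t, (fun m => u m t) @ \oo --> 0) ->
  (forall t, (fun m => du m t) @ \oo --> phi t) ->
  forall t, phi t = 0.
Proof.
move=> udu cdu cphi u0 duphi t; apply/eqP; rewrite eq_le; apply/andP; split.
  exact: derive_limit_le0 udu cdu cphi u0 duphi t.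
rewrite -oppr_le0.
apply: (@derive_limit_le0 _ (fun m s => - u m s) (fun m s => - du m s) (fun s => - phi s)).
- move=> m s; apply: cvgN; exact: cdu.
- move=> s; apply: cvgN; exact: cphi.
- move=> s; rewrite -[X in _ --> X]oppr0; apply: cvgN; exact: u0.
- move=> s; apply: cvgN; exact: duphi.
Qed.

End EvenOdd.

(** * Uniqueness of GCK extensions: vanishing on the real line propagates *)

Section Uniqueness.
Context {R : realType} {n : nat}.
Local Notation Cl := (clifford R n).
Local Notation Pt := 'rV[R]_n.+1.
Variables (G : Pt -> Cl) (h : nat -> R -> Cl).
Hypothesis n_gt0 : (0 < n)%N.
Hypothesis G_monogenic : monogenic G.
Hypothesis h_continuous : forall j A, continuous (fun t => h j t A).
Hypothesis G_sum : forall x, cl_has_sum (fun j => vec_part x ^+ j * h j (x 0 0)) (G x).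

Let l0 : 'I_n := Ordinal n_gt0.
Let pt (t s : R) : Pt := t *: unit_vec R ord0 + s *: unit_vec R (lift ord0 l0).

(** The sign absorbs the square [- vec_sqr x] of the vector part, so the even layers, and likewise
    the odd ones in [b], become power series in [vec_sqr x]. *)
Let a m (t : R) : Cl := (-1) ^+ m *: h m.*2 t.
Let b m (t : R) : Cl := (-1) ^+ m *: h m.*2.+1 t.
Let fa t : R -> Cl := cl_pser (a^~ t).
Let fb t : R -> Cl := cl_pser (b^~ t).

Local Lemma pt0 t s : pt t s 0 0 = t.
Proof. by rewrite /pt addrC line_lift0 !mxE eqxx mulr1. Qed.

Local Lemma pt_line t s k : k *: unit_vec R ord0 + pt t s = pt (k + t) s.
Proof. by rewrite /pt addrA scalerDl. Qed.

Local Lemma vec_pt t s : vec_part (pt t s) = s *: cl_gen l0.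
Proof.
rewrite /pt addrC vec_part_line (_ : vec_part _ = 0) ?add0r //.
exact: vec_part_real.
Qed.

Local Lemma sqr_pt t s : vec_sqr (pt t s) = s ^+ 2.
Proof.
rewrite /pt addrC vec_sqr_line.
have -> : vec_sqr (t *: unit_vec R ord0 : Pt) = 0 by exact: vec_sqr_real.
have -> : (t *: unit_vec R ord0 : Pt) 0 (lift ord0 l0) = 0.
  by rewrite !mxE eq_sym (negbTE (neq_lift _ _)) mulr0.
by rewrite add0r mulr0 mulr0 add0r.
Qed.

Local Lemma even_term (x : Pt) m (t := x 0 0) :
  vec_part x ^+ m.*2 * h m.*2 t = vec_sqr x ^+ m *: a m t.
Proof.
rewrite -mul2n exprM expr2 vec_part_sqr exprZn expr1n -scalerAl mul1r /a.
by rewrite mul2n scalerA [in LHS]exprNn mulrC.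
Qed.

Local Lemma odd_term (x : Pt) m (t := x 0 0) :
  vec_part x ^+ m.*2.+1 * h m.*2.+1 t = vec_part x * (vec_sqr x ^+ m *: b m t).
Proof.
rewrite exprS -mulrA; congr (_ * _).
rewrite -mul2n exprM expr2 vec_part_sqr exprZn expr1n -scalerAl mul1r /b.
by rewrite mul2n scalerA [in LHS]exprNn mulrC.
Qed.

Local Lemma term_bounded x A : exists M, forall j,
  `|(vec_part x ^+ j * h j (x 0 0)) A| <= M.
Proof.
have [M HM] := cvg_has_ub (cvgP _ (cvg_series_cvg_0 (cvgP _ (G_sum (x := x) (A := A))))).
by exists M => j; apply: HM; exists j.
Qed.

(** Radii [s >= 1] suffice because [r <= (1 + r)^2]; for them [b_entire] can discard the extra
    factor [s] of the odd terms. *)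
Local Lemma entire_of_bounds (c : nat -> R) :
  (forall s : R, 1 <= s -> exists M, forall m, (s ^+ 2) ^+ m * `|c m| <= M) -> entire c.
Proof.
move=> H r r0; have [|M HM] := H (1 + r); first by rewrite lerDl.
exists M => m; apply: le_trans (HM m); rewrite mulrC ler_wpM2r //.
by rewrite lerXn2r ?nnegrE ?sqr_ge0 // expr2; nra.
Qed.

Local Lemma a_entire t : cl_entire (a^~ t).
Proof.
move=> A; apply: entire_of_bounds => s s1.
have [M HM] := term_bounded (pt t s) A; exists M => m.
have := HM m.*2; rewrite even_term pt0 clZE sqr_pt normrM ger0_norm //.
by rewrite exprn_ge0 ?sqr_ge0.
Qed.

Local Lemma b_entire t : cl_entire (b^~ t).
Proof.
move=> A; apply: entire_of_bounds => s s1.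
have [M HM] := term_bounded (pt t s) (symdiff [set l0]%SET A); exists M => m.
have H := HM m.*2.+1.
rewrite odd_term pt0 vec_pt sqr_pt -scalerAl -scalerAr !clZE cl_gen_mulE symdiffKs in H.
suff : (s ^+ 2) ^+ m * `|b m t A| <= M by [].
move: (b m t A) H => z; rewrite !normrM.
have -> : `|clsign [set l0]%SET A| = 1 :> R.
  apply/eqP; rewrite -(@eqrXn2 _ 2) // expr1n -normrX ger0_norm ?sqr_ge0 //.
  by rewrite expr2 clsign_sqr.
have s0 : 0 <= (s ^+ 2) ^+ m by rewrite exprn_ge0 ?sqr_ge0.
rewrite mul1r [`|(s ^+ 2) ^+ m|]ger0_norm //.
apply: le_trans; rewrite ler_peMl ?mulr_ge0 //.
by apply: le_trans s1 (ler_norm _).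
Qed.

Local Lemma G_axial : G = axial_fun fa fb.
Proof.
apply/funext => x; apply: (@cl_has_sum_unique _ _
  (fun m => vec_sqr x ^+ m *: a m (x 0 0) + vec_part x * (vec_sqr x ^+ m *: b m (x 0 0)))).
  move=> A; have := series_pairs (G_sum (x := x) (A := A)).
  by under eq_fun do rewrite even_term odd_term -clDE.
apply: cl_has_sumD; first exact/cl_pser_sum/a_entire.
exact/cl_has_sum_vec/cl_pser_sum/b_entire.
Qed.

Local Lemma G_pt t s : G (pt t s) = fa t (s ^+ 2) + s *: (cl_gen l0 * fb t (s ^+ 2)).
Proof. by rewrite G_axial /axial_fun pt0 vec_pt sqr_pt -scalerAl. Qed.

(** Monogenicity trades the [x_0]-derivative for [- vec_dirac G], which is a combination of power
    series in [s ^+ 2]; so its leading order as [s] tends to 0 is known without differentiating any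
    [h j]. *)
Local Lemma G_partial0_pt t s : partial ord0 G (pt t s) =
  n%:R *: fb t (s ^+ 2) + 2 *: cl_pser (fun k => k%:R *: b k t) (s ^+ 2)
  - (2 * s) *: (cl_gen l0 * cl_pser (cl_dcoef (a^~ t)) (s ^+ 2)).
Proof.
have [_ /(_ (pt t s))] := G_monogenic; move/eqP; rewrite addr_eq0 => /eqP ->.
rewrite G_axial (vec_dirac_axial (da := cl_pser (cl_dcoef (a^~ t)) (s ^+ 2))
   (db := cl_pser (cl_dcoef (b^~ t)) (s ^+ 2))); first last.
- by rewrite pt0 sqr_pt; apply: cl_pser_derive; exact: b_entire.
- by rewrite pt0 sqr_pt; apply: cl_pser_derive; exact: a_entire.
rewrite pt0 sqr_pt vec_pt -[(2 * s ^+ 2) *: _]scalerA cl_pser_dcoef; last exact: b_entire.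
by rewrite -scalerAl scalerA !opprB addrA [_ + n%:R *: _]addrC.
Qed.

Local Lemma G_derive_pt s t A : is_derive t (1 : R) (fun r => G (pt r s) A)
  (partial ord0 G (pt t s) A).
Proof.
have [/(_ ord0 A) [dG _] _] := G_monogenic.
apply/is_derive_line; rewrite ffunE.
have /is_derive_line := derivableP (dG (pt t s)).
apply: is_derive_ext => k; rewrite /coord_fun pt_line.
by rewrite [k *: (1 : R)]mulr1.
Qed.

Local Lemma G_partial0_continuous s A : continuous (fun t => partial ord0 G (pt t s) A).
Proof.
have [/(_ ord0 A) [_ cG] _] := G_monogenic.
move=> t; under eq_fun do rewrite ffunE.
pose coord_deriv := 'D_(unit_vec R ord0) (coord_fun G A).
have cpt : pt^~ s r @[r --> t] --> pt t s.
  apply: cvgD; last exact: cvg_cst.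
  by apply: cvgZr_tmp; exact: cvg_id.
exact: (cvg_comp _ coord_deriv cpt (cG (pt t s))).
Qed.

Local Lemma a_continuous m A : continuous (fun t => a m t A).
Proof.
under eq_fun do rewrite clZE.
by move=> t; exact: (cvgM (cvg_cst _) (@h_continuous m.*2 A t)).
Qed.

Local Lemma gen_a_continuous m A : continuous (fun t => (cl_gen l0 * a m t) A).
Proof.
under eq_fun do rewrite cl_gen_mulE.
move=> t; exact: (cvgM (cvg_cst _) (@a_continuous m _ t)).
Qed.

Local Lemma b_continuous m A : continuous (fun t => b m t A).
Proof.
under eq_fun do rewrite clZE.
by move=> t; exact: (cvgM (cvg_cst _) (@h_continuous m.*2.+1 A t)).
Qed.

Let s_ k : R := k.+1%:R^-1.
Let r_ k : R := s_ k ^+ 2.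

Local Lemma s_neq0 k : s_ k != 0.
Proof. by rewrite invr_eq0 pnatr_eq0. Qed.

Local Lemma r_neq0 k : r_ k != 0.
Proof. by rewrite expf_neq0 // s_neq0. Qed.

Local Lemma s_cvg0 : s_ @ \oo --> (0 : R).
Proof. exact: cvg_harmonic. Qed.

Local Lemma r_cvg0 : r_ @ \oo --> (0 : R).
Proof. by rewrite -[X in _ --> X](mulr0 (0 : R)); apply: cvgM; exact: s_cvg0. Qed.

Local Lemma cvg0_s (u : nat -> R) (l : R) :
  u @ \oo --> l -> (fun k => s_ k * u k) @ \oo --> 0.
Proof. by move=> ul; rewrite -[X in _ --> X](mul0r l); exact: cvgM s_cvg0 ul. Qed.

Local Lemma b_eq0 m : (forall i t, (i <= m)%N -> a i t = 0) ->
  (forall i t, (i < m)%N -> b i t = 0) -> forall t, b m t = 0.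
Proof.
move=> a0 b0 t; apply/ffunP => A; rewrite cl0E.
(* The limit of the [x_0]-derivative divided by [s^(2m)]: [n] comes from the sum of the [e_l^2], and
   [2 m] from [2 p d/dp] acting on [p^m]. The function itself, divided by [s^(2m)], tends to
   [a m = 0]. *)
pose phi s := (n%:R + 2 * m%:R) * b m s A.
suff : phi t = 0.
  move/eqP; rewrite mulf_eq0 => /orP[|/eqP //].
  by rewrite -natrM -natrD pnatr_eq0 addn_eq0 -[n == 0%N]negbK -lt0n n_gt0.
move: t; apply: (@derive_limit_eq0 _ (fun k t => G (pt t (s_ k)) A / r_ k ^+ m)
  (fun k t => partial ord0 G (pt t (s_ k)) A / r_ k ^+ m)).
- move=> k t; have := is_deriveZ (r_ k ^+ m)^-1 (G_derive_pt (s_ k) t A).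
  by rewrite [_ *: _]mulrC; apply: is_derive_ext => y; exact: mulrC.
- move=> k t; apply: cvgMr_tmp; exact: G_partial0_continuous.
- move=> t; apply: cvgMl_tmp; exact: b_continuous.
- move=> t; apply: (@cvg_seq_ext _ _ (fun k => fa t (r_ k) A / r_ k ^+ m
      + s_ k * ((cl_gen l0 * fb t (r_ k)) A / r_ k ^+ m)) _ (a m t A + 0)).
  + by move=> k; rewrite G_pt clDE clZE mulrDl -mulrA.
  + by rewrite a0 // cl0E addr0.
  apply: cvgD.
    apply: (cl_pser_lead (a_entire t) _ r_neq0 r_cvg0) => i im.
    by rewrite a0 // ltnW.
  apply: cvg0_s; apply: (cl_pser_lead_gen (b_entire t) _ r_neq0 r_cvg0) => i im.
  by rewrite b0.
- move=> t; apply: (@cvg_seq_ext _ _ (fun k => n%:R * (fb t (r_ k) A / r_ k ^+ m)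
      + 2 * (cl_pser (fun k => k%:R *: b k t) (r_ k) A / r_ k ^+ m)
      - s_ k * (2 * ((cl_gen l0 * cl_pser (cl_dcoef (a^~ t)) (r_ k)) A / r_ k ^+ m)))
      _ (n%:R * b m t A + 2 * (m%:R * b m t A) - 0)).
  + by move=> k; rewrite G_partial0_pt clDE clNE clDE !clZE -/(r_ k); ring.
  + by rewrite /phi; ring.
  apply: cvgB; first apply: cvgD.
  + apply: cvgMl_tmp; apply: (cl_pser_lead (b_entire t) _ r_neq0 r_cvg0) => i im.
    by rewrite b0.
  + apply: cvgMl_tmp; rewrite -clZE.
    apply: (cl_pser_lead (cl_entire_nat (b_entire t)) _ r_neq0 r_cvg0) => i im.
    by rewrite b0 // scaler0.
  + apply: cvg0_s; apply: cvgMl_tmp.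
    apply: (cl_pser_lead_gen (cl_entire_deriv (a_entire t)) _ r_neq0 r_cvg0) => i im.
    by rewrite /cl_dcoef a0 ?scaler0.
Qed.

Local Lemma a_eq0 m : (forall i t, (i <= m)%N -> a i t = 0) ->
  (forall i t, (i <= m)%N -> b i t = 0) -> forall t, a m.+1 t = 0.
Proof.
move=> a0 b0 t; apply: (@cl_gen_mul_eq0 _ _ l0); apply/ffunP => A; rewrite cl0E.
(* Now the division is by [s^(2m+1)]: the function tends to [e_1 b m = 0], and the first surviving
   term of the derivative is [- 2 s e_1] times the [p]-derivative of [a m.+1 * p^(m+1)]. *)
pose phi s := - (2 * m.+1%:R) * (cl_gen l0 * a m.+1 s) A.
suff : phi t = 0.
  move/eqP; rewrite mulf_eq0 oppr_eq0 -natrM pnatr_eq0 => /orP[|/eqP //].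
  by rewrite muln_eq0.
move: t; apply: (@derive_limit_eq0 _ (fun k t => G (pt t (s_ k)) A / (s_ k * r_ k ^+ m))
  (fun k t => partial ord0 G (pt t (s_ k)) A / (s_ k * r_ k ^+ m))).
- move=> k t; have := is_deriveZ (s_ k * r_ k ^+ m)^-1 (G_derive_pt (s_ k) t A).
  by rewrite [_ *: _]mulrC; apply: is_derive_ext => y; exact: mulrC.
- move=> k t; apply: cvgMr_tmp; exact: G_partial0_continuous.
- move=> t; apply: cvgMl_tmp; exact: gen_a_continuous.
- move=> t; apply: (@cvg_seq_ext _ _ (fun k => s_ k * (fa t (r_ k) A / r_ k ^+ m.+1)
      + (cl_gen l0 * fb t (r_ k)) A / r_ k ^+ m) _ (0 + (cl_gen l0 * b m t) A)).
  + move=> k; rewrite G_pt clDE clZE -/(r_ k) exprS /r_; field.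
    by rewrite ?expf_neq0 ?s_neq0.
  + by rewrite b0 // mulr0 cl0E addr0.
  apply: cvgD.
    apply: cvg0_s; apply: (cl_pser_lead (a_entire t) _ r_neq0 r_cvg0) => i im.
    by rewrite a0.
  apply: (cl_pser_lead_gen (b_entire t) _ r_neq0 r_cvg0) => i im.
  by rewrite b0 // ltnW.
- move=> t; apply: (@cvg_seq_ext _ _ (fun k =>
      s_ k * (n%:R * (fb t (r_ k) A / r_ k ^+ m.+1))
      + s_ k * (2 * (cl_pser (fun k => k%:R *: b k t) (r_ k) A / r_ k ^+ m.+1))
      - 2 * ((cl_gen l0 * cl_pser (cl_dcoef (a^~ t)) (r_ k)) A / r_ k ^+ m))
      _ (0 + 0 - 2 * (cl_gen l0 * cl_dcoef (a^~ t) m) A)).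
  + move=> k; rewrite G_partial0_pt clDE clNE clDE !clZE -/(r_ k) exprS /r_; field.
    by rewrite ?expf_neq0 ?s_neq0.
  + have -> : cl_gen l0 * cl_dcoef (a^~ t) m = m.+1%:R *: (cl_gen l0 * a m.+1 t).
      by rewrite /cl_dcoef -scalerAr.
    by rewrite /phi clZE; ring.
  apply: cvgB; first apply: cvgD.
  + apply: cvg0_s; apply: cvgMl_tmp.
    apply: (cl_pser_lead (b_entire t) _ r_neq0 r_cvg0) => i im.
    by rewrite b0.
  + apply: cvg0_s; apply: cvgMl_tmp.
    apply: (cl_pser_lead (cl_entire_nat (b_entire t)) _ r_neq0 r_cvg0) => i im.
    by rewrite b0 // scaler0.
  + apply: cvgMl_tmp.
    apply: (cl_pser_lead_gen (cl_entire_deriv (a_entire t)) _ r_neq0 r_cvg0) => i im.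
    by rewrite /cl_dcoef a0 ?scaler0.
Qed.

(** The values on the real line are those of [a 0]; then [b_eq0] and [a_eq0] alternate, killing
    [b 0], [a 1], [b 1] and so on. *)
Lemma gck_vanish : (forall t, G (real_point n t) = 0) -> forall x, G x = 0.
Proof.
move=> G0.
have a00 t : a 0 t = 0.
  rewrite -(cl_pser0 (a_entire t)) -/(fa t) -(G0 t) G_axial /axial_fun.
  by rewrite vec_part_real mul0r addr0 vec_sqr_real real_point0.
have ab m : (forall i t, (i <= m)%N -> a i t = 0) /\ (forall i t, (i < m)%N -> b i t = 0).
  elim: m => [|m [IHa IHb]].
    by split=> // i t; rewrite leqn0 => /eqP ->.
  have IHb' i t : (i <= m)%N -> b i t = 0.
    by rewrite leq_eqVlt => /orP[/eqP ->|]; [exact: b_eq0|exact: IHb].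
  split=> // i t; rewrite leq_eqVlt => /orP[/eqP ->|]; last exact: IHa.
  exact: a_eq0.
move=> x; apply: cl_has_sum_unique (G_sum (x := x)) _ => A.
rewrite cl0E (_ : series _ = cst 0); first exact: cvg_cst.
apply/funext => m; rewrite /series /= big1 // => j _.
rewrite -[j]odd_double_half; case: (odd j); rewrite ?add1n ?add0n.
  by rewrite odd_term (proj2 (ab j./2.+1)) // scaler0 mulr0 cl0E.
by rewrite even_term (proj1 (ab j./2)) // scaler0 cl0E.
Qed.

End Uniqueness.

Section GCKUnique.
Context {R : realType} {n : nat}.
Local Notation Cl := (clifford R n).
Local Notation Pt := 'rV[R]_n.+1.

Lemma is_gck_unique (f0 : R -> Cl) (F H : Pt -> Cl) : (0 < n)%N ->
  is_gck f0 F -> is_gck f0 H -> F = H.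
Proof.
move=> n_gt0 [[[C1F eF] _] [hF [aF sF]] rF] [[[C1H eH] _] [hH [aH sH]] rH].
have DB i A x : is_derive x (unit_vec R i) (coord_fun (fun x => F x - H x) A)
    ('D_(unit_vec R i) (coord_fun F A) x - 'D_(unit_vec R i) (coord_fun H A) x).
  have [[dF _] [dH _]] := (C1F i A, C1H i A).
  rewrite (_ : coord_fun _ A = coord_fun F A - coord_fun H A).
    exact: is_deriveB (derivableP (dF x)) (derivableP (dH x)).
  by apply/funext => y; rewrite /coord_fun clDE clNE.
have PB i x : partial i (fun x => F x - H x) x = partial i F x - partial i H x.
  by apply/ffunP => A; rewrite clDE clNE !ffunE; have [_ ->] := DB i A x.
apply/funext => x; apply/eqP; rewrite -subr_eq0; apply/eqP.
apply: (@gck_vanish R n (fun x => F x - H x) (fun j t => hF j t - hH j t) n_gt0).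
- split=> [i A|y].
    split=> [y|]; first by have [] := DB i A y.
    rewrite (_ : 'D_ _ _ = fun y =>
      'D_(unit_vec R i) (coord_fun F A) y - 'D_(unit_vec R i) (coord_fun H A) y).
      by move=> y; exact: cvgB ((C1F i A).2 y) ((C1H i A).2 y).
    by apply/funext => y; have [_ ->] := DB i A y.
  rewrite PB (_ : vec_dirac _ y = vec_dirac F y - vec_dirac H y).
    by rewrite addrACA eF -opprD eH subr0.
  rewrite /vec_dirac -sumrB; apply: eq_bigr => l _.
  by rewrite PB mulrBr.
- move=> j A; under eq_fun do rewrite clDE clNE.
  move=> t; exact: cvgB (@real_analytic_continuous _ _ _ A (aF j) t)
    (@real_analytic_continuous _ _ _ A (aH j) t).
- move=> y; rewrite -[- H y]scaleN1r.
  have := cl_has_sumD (sF y) (cl_has_sumZ (r := -1) (sH y)).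
  by under eq_fun do rewrite scaleN1r -mulrBr.
- by move=> t; rewrite rF rH subrr.
Qed.

Lemma gckE (f0 : R -> Cl) (F : Pt -> Cl) : (0 < n)%N -> is_gck f0 F -> gck f0 = F.
Proof.
move=> n_gt0 FF; apply: (is_gck_unique n_gt0 _ FF).
by rewrite /gck; case: xgetP => [G _ //|/(_ F)].
Qed.

End GCKUnique.

(** * The Fock space in coefficients, duality and adjoints *)

Section Fock.
Context {R : realType} {n : nat}.
Hypothesis n_gt0 : (0 < n)%N.
Local Notation Cl := (clifford R n).
Local Notation Pt := 'rV[R]_n.+1.
Implicit Types (alpha beta eta : nat -> Cl) (f g : Pt -> Cl).

Definition cl_shift alpha : nat -> Cl := fun k => if k is k'.+1 then alpha k' else 0.

Lemma entire_unshift (c : nat -> R) : entire (fun k => c k.+1) -> entire c.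
Proof.
move=> ec r r0; have [M cM] := ec r r0; exists (`|c 0| + r * M) => -[|k].
  have M0 : 0 <= M by apply: le_trans (cM 0); rewrite expr0 mulr1.
  by rewrite expr0 mulr1 lerDl mulr_ge0.
rewrite exprS mulrCA; apply: le_trans (ler_wpM2l r0 (cM k)) _.
by rewrite lerDr.
Qed.

Lemma cl_entire_shift alpha : cl_entire alpha -> cl_entire (cl_shift alpha).
Proof. by move=> ea A; apply: entire_unshift; exact: ea. Qed.

Lemma appell_sum_inj alpha beta : cl_entire alpha -> cl_entire beta ->
  (forall t, appell_sum alpha (real_point n t) = appell_sum beta (real_point n t)) ->
  alpha = beta.
Proof.
move=> ea eb ab; apply/funext => k; apply/ffunP => A; apply/eqP; rewrite -subr_eq0.
have eN : entire (fun j => -1 * beta j A) by exact: entireZ.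
apply/eqP; rewrite -mulN1r.
apply: (pser_eq0 (entireD (ea A) eN) _ k) => t.
have := ab t => /ffunP/(_ A); rewrite !appell_sum_real => abt.
rewrite /pser wsumDr; last 2 first.
- exact: cvgP (pser_cvg (ea A)).
- exact: cvgP (pser_cvg eN).
have -> : wsum (fun k => t ^+ k) (fun j => -1 * beta j A) =
    -1 * pser (fun j => beta j A) t.
  apply: wsumE; under eq_fun do rewrite mulrCA.
  by apply: series_cvgZ; exact: (pser_cvg (eb A)).
by rewrite -/(pser _ t) abt mulN1r subrr.
Qed.

Lemma fock_expansionE f alpha : fock_expansion f alpha ->
  cl_entire alpha /\ f = appell_sum alpha.
Proof.
move=> [sa fa]; have ea := fock_summable_entire sa; split=> //.
by apply/funext => x; apply: cl_has_sum_unique (fa x) (appell_sumP n_gt0 ea).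
Qed.

Lemma fock_expansion_sum alpha : fock_summable alpha ->
  fock_expansion (appell_sum alpha) alpha.
Proof.
by move=> sa; split=> // x; exact/(appell_sumP n_gt0)/fock_summable_entire.
Qed.

Lemma fock_appell_sum alpha : cl_entire alpha ->
  fock (appell_sum alpha) -> fock_summable alpha.
Proof.
move=> ea [beta fb]; have [eb ab] := fock_expansionE fb.
by rewrite (appell_sum_inj ea eb) => [|t]; [exact: fb.1|rewrite ab].
Qed.

Lemma fock_coef_sum alpha : fock_summable alpha -> fock_coef (appell_sum alpha) = alpha.
Proof.
move=> sa; rewrite /fock_coef; case: xgetP => [beta _ fb|/(_ alpha)]; last first.
  by have := fock_expansion_sum sa.
have [eb ab] := fock_expansionE fb.
by apply: appell_sum_inj => // [|t]; [exact: fock_summable_entire|rewrite ab].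
Qed.

Definition fock_pairing alpha beta : Cl :=
  cl_sum (fun k => k`!%:R *: (cl_conj (alpha k) * beta k)).

Lemma fock_inner_sum alpha beta : fock_summable alpha -> fock_summable beta ->
  fock_inner (appell_sum alpha) (appell_sum beta) =
  fock_pairing alpha beta.
Proof. by move=> sa sb; rewrite /fock_inner !fock_coef_sum. Qed.

(** On the real line [P_1^n] is [t], and multiplying a power series by [t] shifts its coefficients;
    existence and uniqueness of the GCK extension carry this over to all of the space. *)
Lemma creation_appell_sum alpha : cl_entire alpha ->
  creation (appell_sum alpha) = appell_sum (cl_shift alpha).
Proof.
move=> ea; rewrite /creation /gck_mul.
have -> : (fun t => appell 1 (real_point n t) * appell_sum alpha (real_point n t)) =
    (fun t => appell_sum (cl_shift alpha) (real_point n t)).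
  apply/funext => t; rewrite appell_real // -scalerAl mul1r; apply/ffunP => A.
  rewrite clZE !appell_sum_real [RHS]pserS /=; last exact: (cl_entire_shift ea A).
  by rewrite cl0E add0r.
apply: gckE => //; apply: appell_sum_is_gck => //; exact: cl_entire_shift.
Qed.

Lemma op_domain_annihilation f : op_domain (@annihilation R n) f <->
  exists alpha,
    [/\ fock_summable alpha, fock_summable (cl_dcoef alpha) & f = appell_sum alpha].
Proof.
split=> [[[alpha fa] fT]|[alpha [sa sd ->]]].
  have [ea fE] := fock_expansionE fa; exists alpha; split=> //; first exact: fa.1.
  move: fT; rewrite fE annihilation_appell_sum //; apply: fock_appell_sum.
  exact: cl_entire_deriv.
split; first by exists alpha; exact: fock_expansion_sum.
rewrite annihilation_appell_sum //; last exact: fock_summable_entire.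
by exists (cl_dcoef alpha); exact: fock_expansion_sum.
Qed.

Lemma op_domain_creation f : op_domain (@creation R n) f <->
  exists alpha,
    [/\ fock_summable alpha, fock_summable (cl_shift alpha) & f = appell_sum alpha].
Proof.
split=> [[[alpha fa] fT]|[alpha [sa ss ->]]].
  have [ea fE] := fock_expansionE fa; exists alpha; split=> //; first exact: fa.1.
  move: fT; rewrite fE creation_appell_sum //; apply: fock_appell_sum.
  exact: cl_entire_shift.
split; first by exists alpha; exact: fock_expansion_sum.
rewrite creation_appell_sum //; last exact: fock_summable_entire.
by exists (cl_shift alpha); exact: fock_expansion_sum.
Qed.

Lemma cl_sum_shift (u : nat -> Cl) : u 0 = 0 -> cl_sum u = cl_sum (fun k => u k.+1).
Proof.
(* Both sides are the value that [get] chooses for the predicate of being a limit, and the two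
   predicates agree; the equality therefore covers divergent series too. *)
move=> u0; apply/ffunP => A; rewrite !ffunE; congr (get _); apply/funext => l.
apply/propext; split=> /=.
  by move=> H; apply/(series_shift0 (u := fun k => u k A)) => //; rewrite u0 cl0E.
by move=> H; apply/series_shift0 => //; rewrite u0 cl0E.
Qed.

Lemma fock_pairing_dcoefl alpha beta :
  fock_pairing (cl_dcoef alpha) beta = fock_pairing alpha (cl_shift beta).
Proof.
rewrite [RHS]cl_sum_shift; last by rewrite mulr0 scaler0.
congr cl_sum; apply/funext => k.
by rewrite /cl_dcoef linearZ /= -scalerAl scalerA -natrM factS mulnC.
Qed.

Lemma fock_pairing_dcoefr alpha beta :
  fock_pairing alpha (cl_dcoef beta) = fock_pairing (cl_shift alpha) beta.
Proof.
rewrite [RHS]cl_sum_shift; last by rewrite linear0 mul0r scaler0.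
congr cl_sum; apply/funext => k.
by rewrite /cl_dcoef -scalerAr scalerA -natrM factS mulnC.
Qed.

Lemma fock_inner_annihilationl alpha beta :
  fock_summable alpha -> fock_summable (cl_dcoef alpha) -> fock_summable beta ->
  fock_inner (annihilation (appell_sum alpha)) (appell_sum beta) =
  fock_pairing (cl_dcoef alpha) beta.
Proof.
move=> /fock_summable_entire ea sda sb.
by rewrite annihilation_appell_sum // fock_inner_sum.
Qed.

Lemma fock_inner_annihilationr alpha beta :
  fock_summable alpha -> fock_summable beta -> fock_summable (cl_dcoef beta) ->
  fock_inner (appell_sum alpha) (annihilation (appell_sum beta)) =
  fock_pairing alpha (cl_dcoef beta).
Proof.
move=> sa /fock_summable_entire eb sdb.
by rewrite annihilation_appell_sum // fock_inner_sum.
Qed.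

Lemma fock_inner_creationl alpha beta :
  fock_summable alpha -> fock_summable (cl_shift alpha) -> fock_summable beta ->
  fock_inner (creation (appell_sum alpha)) (appell_sum beta) =
  fock_pairing (cl_shift alpha) beta.
Proof.
move=> /fock_summable_entire ea ssa sb.
by rewrite creation_appell_sum // fock_inner_sum.
Qed.

Lemma fock_inner_creationr alpha beta :
  fock_summable alpha -> fock_summable beta -> fock_summable (cl_shift beta) ->
  fock_inner (appell_sum alpha) (creation (appell_sum beta)) =
  fock_pairing alpha (cl_shift beta).
Proof.
move=> sa /fock_summable_entire eb ssb.
by rewrite creation_appell_sum // fock_inner_sum.
Qed.

(** The coefficients of [P_m^n], the test functions for the adjoints. *)
Definition unit_coef m : nat -> Cl := fun k => (k == m)%:R.

Lemma cl_sum1 (u : nat -> Cl) m : (forall k, k != m -> u k = 0) -> cl_sum u = u m.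
Proof.
move=> u0; apply/ffunP => A; rewrite ffunE; apply: cvg_lim => //.
rewrite -(cvg_shiftn m.+1).
rewrite (_ : [sequence _]_k = cst (u m A)); first exact: cvg_cst.
apply/funext => k; rewrite /= /series /= (bigD1_seq m) ?iota_uniq //=; last first.
  by rewrite mem_index_iota /= addnS ltnS leq_addl.
by rewrite big1 ?addr0 // => j jm; rewrite u0 // cl0E.
Qed.

Lemma fock_summable_fin alpha m :
  (forall k, (m <= k)%N -> alpha k = 0) -> fock_summable alpha.
Proof.
move=> a0; apply/cvg_ex; exists (series (fun k => k`!%:R * cl_norm (alpha k) ^+ 2) m).
rewrite -(cvg_shiftn m) (_ : [sequence _]_k =
  cst (series (fun k => k`!%:R * cl_norm (alpha k) ^+ 2) m)); first exact: cvg_cst.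
apply/funext => k; rewrite /= /series /= (big_cat_nat _ (n := m)) ?leq_addl //=.
rewrite [X in _ + X](_ : _ = 0) ?addr0 //.
rewrite big_nat_cond big1 // => j; rewrite andbT => /andP[mj _].
by rewrite a0 // cl_norm_sqr big1 ?mulr0 // => A _; rewrite cl0E expr0n.
Qed.

Lemma fock_summable_unit m : fock_summable (unit_coef m).
Proof.
apply: (@fock_summable_fin _ m.+1) => k mk.
by rewrite /unit_coef gtn_eqF.
Qed.

Lemma fock_summable_unit_dcoef m : fock_summable (cl_dcoef (unit_coef m)).
Proof.
apply: (@fock_summable_fin _ m) => k mk.
by rewrite /cl_dcoef /unit_coef gtn_eqF ?scaler0.
Qed.

Lemma fock_summable_unit_shift m : fock_summable (cl_shift (unit_coef m)).
Proof.
apply: (@fock_summable_fin _ m.+2) => -[|k] //= mk.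
by rewrite /unit_coef gtn_eqF.
Qed.

Lemma fock_pairing_unit alpha m :
  fock_pairing alpha (unit_coef m) = m`!%:R *: cl_conj (alpha m).
Proof.
rewrite /fock_pairing (@cl_sum1 _ m) => [|k km].
  by rewrite /unit_coef eqxx mulr1.
by rewrite /unit_coef (negbTE km) mulr0 scaler0.
Qed.

Lemma coef_eq_of_unit alpha beta :
  (forall m, fock_pairing alpha (unit_coef m) = fock_pairing beta (unit_coef m)) ->
  alpha = beta.
Proof.
move=> ab; apply/funext => m; have := ab m; rewrite !fock_pairing_unit.
move/(scalerI _) => /(_ _)/(can_inj cl_conjK); apply.
by rewrite pnatr_eq0 -lt0n fact_gt0.
Qed.

Lemma annihilation_creation_dual f g :
  op_domain (@annihilation R n) f -> op_domain (@creation R n) g ->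
  fock_inner (annihilation f) g = fock_inner f (creation g).
Proof.
move=> /op_domain_annihilation[alpha [sa sda ->]] /op_domain_creation[beta [sb ssb ->]].
apply: etrans (fock_inner_annihilationl sa sda sb) _.
apply: etrans (fock_pairing_dcoefl _ _) _.
exact: esym (fock_inner_creationr sa sb ssb).
Qed.

Lemma creation_annihilation_dual f g :
  op_domain (@creation R n) f -> op_domain (@annihilation R n) g ->
  fock_inner (creation f) g = fock_inner f (annihilation g).
Proof.
move=> /op_domain_creation[alpha [sa ssa ->]] /op_domain_annihilation[beta [sb sdb ->]].
apply: etrans (fock_inner_creationl sa ssa sb) _.
apply: etrans (esym (fock_pairing_dcoefr _ _)) _.
exact: esym (fock_inner_annihilationr sa sb sdb).
Qed.

(** Testing with [P_m^n] for all [m] shows that the coefficients of [h] are the shifted ones of [f].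
    Their summability, known because [h] is in the Fock space, is what membership of [f] in the
    domain of creation requires. *)
Lemma annihilation_adjoint_sub f h :
  fock f -> fock h ->
  (forall g, op_domain (@annihilation R n) g ->
    fock_inner h g = fock_inner f (annihilation g)) ->
  op_domain (@creation R n) f /\ h = creation f.
Proof.
move=> [alpha fa] [eta he] adj.
have [[ea fE] [_ hE]] := (fock_expansionE fa, fock_expansionE he).
have [[sa _] [se _]] := (fa, he).
have eE : eta = cl_shift alpha.
  apply: coef_eq_of_unit => m.
  have su := @fock_summable_unit m; have sd := @fock_summable_unit_dcoef m.
  have := adj (appell_sum (unit_coef m)); rewrite fE hE => adjm.
  apply: etrans (esym (fock_inner_sum se su)) _; apply: etrans (adjm _) _.
    by apply/op_domain_annihilation; exists (unit_coef m); split; [exact: su|exact: sd|].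
  apply: etrans (fock_inner_annihilationr sa su sd) _.
  exact: fock_pairing_dcoefr.
have -> : h = creation f by rewrite hE fE creation_appell_sum // eE.
split; last by [].
by apply/op_domain_creation; exists alpha; split; [exact: sa|rewrite -eE; exact: se|].
Qed.

Lemma creation_adjoint_sub f h :
  fock f -> fock h ->
  (forall g, op_domain (@creation R n) g -> fock_inner h g = fock_inner f (creation g)) ->
  op_domain (@annihilation R n) f /\ h = annihilation f.
Proof.
move=> [alpha fa] [eta he] adj.
have [[ea fE] [_ hE]] := (fock_expansionE fa, fock_expansionE he).
have [[sa _] [se _]] := (fa, he).
have eE : eta = cl_dcoef alpha.
  apply: coef_eq_of_unit => m.
  have su := @fock_summable_unit m; have ss := @fock_summable_unit_shift m.
  have := adj (appell_sum (unit_coef m)); rewrite fE hE => adjm.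
  apply: etrans (esym (fock_inner_sum se su)) _; apply: etrans (adjm _) _.
    by apply/op_domain_creation; exists (unit_coef m); split; [exact: su|exact: ss|].
  apply: etrans (fock_inner_creationr sa su ss) _.
  exact: esym (fock_pairing_dcoefl _ _).
have -> : h = annihilation f by rewrite hE fE annihilation_appell_sum // eE.
split; last by [].
by apply/op_domain_annihilation; exists alpha; split; [exact: sa|rewrite -eE; exact: se|].
Qed.

End Fock.

Theorem proposition5p8 (R : realType) (n : nat) (n_odd : odd n) :
  let creat := @creation R n in
  let annih := @annihilation R n in
  [/\ forall f g, op_domain annih f -> op_domain creat g ->
        fock_inner (annih f) g = fock_inner f (creat g),
      adjoint_graph (op_domain annih) annih = op_graph (op_domain creat) creat
    & adjoint_graph (op_domain creat) creat = op_graph (op_domain annih) annih].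
Proof.
have n_gt0 := odd_gt0 n_odd; split.
- exact: annihilation_creation_dual.
(* The converse inclusion is the duality identity with the roles of the two operators exchanged. *)
- apply/seteqP; split=> -[f h]; first by case; exact: annihilation_adjoint_sub.
  move=> [/= Df ->]; split=> [||g /= Dg]; [exact: Df.1|exact: Df.2|].
  exact: creation_annihilation_dual.
- apply/seteqP; split=> -[f h]; first by case; exact: creation_adjoint_sub.
  move=> [/= Df ->]; split=> [||g /= Dg]; [exact: Df.1|exact: Df.2|].
  exact: annihilation_creation_dual.
Qed.
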